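(* There exists a universal constant $C_0>0$ such that the following holds. Let $n,r\ge2$ be integers, let $\varepsilon\in(0,1)$, and let $T\in(\mathbb R^n)^{\otimes r}$ be a random tensor with independent (integrable, possibly unbounded) real entries such that, for some $L\ge1$, $\Pr(T_i\ne0)\le L\,n^{-1-\varepsilon}$ for all $i\in[n]^r$. Let $$C(r,\varepsilon):=\begin{cases}\dfrac{r^4}{\varepsilon}&\text{if } r\le\dfrac{\varepsilon\log n}{5\log\log n},\\[2mm]\dfrac{r^5}{\varepsilon^2}\log^2\dfrac r\varepsilon&\text{otherwise.}\end{cases}$$ Then $$\mathbb E\,\|T-\mathbb E T\|_{\mathrm{inj}}\le C_0\,C(r,\varepsilon)\,L\,\mathbb E\|T\|_\infty .$$ Moreover, for any $t>0$ and any $M\ge2\,\mathbb E\|T\|_\infty$, $$\Pr\Big(\|T-\mathbb E T\|_{\mathrm{inj}}>C_0\,L M\Big(C(r,\varepsilon)+\frac{r^3t}{\varepsilon}\Big)\Big)\le n^{-t}+\Pr\big(\|T\|_\infty>M\big).$$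
   Context: $[n]=\{1,\dots,n\}$; $\log$ is the natural logarithm (for $n=2$ the quantity $\frac{\varepsilon\log n}{5\log\log n}$ is negative, so the second case applies); $\mathbb E T$ is the entrywise expectation; $\|T\|_\infty=\max_{i\in[n]^r}|T_i|$. The injective norm of $T\in(\mathbb R^n)^{\otimes r}$ is $\|T\|_{\mathrm{inj}}=\max\{|\langle T,x_1\otimes\cdots\otimes x_r\rangle| : x_1,\dots,x_r\in\mathbb R^n,\ \|x_1\|_2=\dots=\|x_r\|_2=1\}$, where $\langle T,X\rangle=\sum_{i\in[n]^r}T_iX_i$. *)

(* Defs.v *)
From HB Require Import structures.
From mathcomp Require Import all_boot all_order all_algebra.
From mathcomp Require Import all_classical all_reals all_analysis.

Set Implicit Arguments.
Unset Strict Implicit.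
Unset Printing Implicit Defensive.

Import Order.TTheory GRing.Theory Num.Theory.
Import numFieldNormedType.Exports.
Local Open Scope classical_set_scope.
Local Open Scope ring_scope.

Section Tensors.
Context {R : realType}.

(* [n]^r, numbered from 0. *)
Definition tensor_index (n r : nat) : finType := {ffun 'I_r -> 'I_n}.

Definition tensor (n r : nat) : Type := tensor_index n r -> R.

Definition tensor_dot n r (T X : tensor n r) : R := \sum_i T i * X i.

Definition pure_tensor n r (x : 'I_r -> 'rV[R]_n) : tensor n r :=
  fun i => \prod_(k < r) x k ord0 (i k).

(* The library norm on 'rV[R]_n is the sup norm, so it cannot be used here. *)
Definition l2norm n (x : 'rV[R]_n) : R := Num.sqrt (\sum_(j < n) x ord0 j ^+ 2).

Definition inj_values n r (T : tensor n r) : set R :=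
  [set v | exists2 x : 'I_r -> 'rV[R]_n,
     (forall k, l2norm (x k) = 1) & v = `|tensor_dot T (pure_tensor x)| ].

(* For n >= 1 the supremum is attained: see inj_normP below. *)
Definition inj_norm n r (T : tensor n r) : R := sup (inj_values T).

Lemma inj_normP n r (T : tensor n r) : (0 < n)%N ->
  inj_values T (inj_norm T) /\ ubound (inj_values T) (inj_norm T).
Proof.
move=> n0.
pose X (v : 'rV[R]_(r * n)) (k : 'I_r) : 'rV[R]_n :=
  \row_j v ord0 (mxvec_index k j).
pose A : set 'rV[R]_(r * n) :=
  [set v | forall k, \sum_(j < n) v ord0 (mxvec_index k j) ^+ 2 = 1].
pose f v : R := `|tensor_dot T (pure_tensor (X v))|.
have l2X v k : l2norm (X v k) =
    Num.sqrt (\sum_(j < n) v ord0 (mxvec_index k j) ^+ 2).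
  by rewrite /l2norm; congr Num.sqrt; apply: eq_bigr => j _; rewrite mxE.
have AX v : A v -> forall k, l2norm (X v k) = 1.
  by move=> Av k; rewrite l2X Av sqrtr1.
have XA (x : 'I_r -> 'rV[R]_n) : (forall k, l2norm (x k) = 1) ->
    exists2 v, A v & X v = x.
  move=> x1; exists (mxvec (\matrix_(k, j) x k ord0 j)).
    move=> k; have := x1 k; rewrite /l2norm => /(congr1 (fun z => z ^+ 2)).
    rewrite sqr_sqrtr ?expr1n; last by apply: sumr_ge0 => j _; exact: sqr_ge0.
    by move=> <-; apply: eq_bigr => j _; rewrite mxvecE mxE.
  apply/funext => k; apply/rowP => j; rewrite mxE mxvecE mxE.
  by [].
have cA : compact A.
  apply: bounded_closed_compact.
    exists 1; split; first exact: num_real.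
    move=> M M1 v Av /=; apply: le_trans (ltW M1).
    rewrite (_ : `|v| = mx_norm v)// mx_normrE.
    apply: bigmax_le => // -[i l] _ /=; rewrite (ord1 i).
    case/mxvec_indexP: l => k j; rewrite -(@expr_le1 _ 2)// real_normK ?num_real//.
    rewrite -(Av k) (bigD1 j)//= lerDl; apply: sumr_ge0 => ? _; exact: sqr_ge0.
  rewrite (_ : A = \bigcap_(k in [set: 'I_r])
      ((fun v : 'rV[R]_(r * n) => \sum_(j < n) v ord0 (mxvec_index k j) ^+ 2)
        @^-1` [set 1])); last first.
    by apply/seteqP; split => v Av k; [move=> _; exact: Av | exact: Av].
  apply: closed_bigI => k _; apply: preimage_closed; last exact: closed_eq.
  move=> v _; move: v.
  apply: continuous_big => [|j _ v]; first exact: add_continuous.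
  apply: (continuous_comp (g := fun y : R => y ^+ 2)).
    exact: coord_continuous.
  exact: exprn_continuous.
have cf : continuous f.
  have cd : continuous (fun v => tensor_dot T (pure_tensor (X v))); last first.
    by move=> v; apply: continuous_comp; [exact: cd | exact: norm_continuous].
  rewrite /tensor_dot.
  apply: continuous_big => [|i _ v]; first exact: add_continuous.
  apply: (@continuousM _ _ (fun=> T i) (fun u => pure_tensor (X u) i)).
    exact: cst_continuous.
  have -> : (fun u => pure_tensor (X u) i) =
      (fun u => \prod_(k < r) u ord0 (mxvec_index k (i k))).
    by apply/funext => u; apply: eq_bigr => k _; rewrite mxE.
  move: v; apply: continuous_big => [|k _ v]; first exact: mul_continuous.
  exact: coord_continuous.
have A0 : A !=set0.
  have [|v Av _] := XA (fun=> delta_mx ord0 (Ordinal n0)); last by exists v.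
  move=> k; rewrite /l2norm (bigD1 (Ordinal n0))//= big1 => [|j jn0].
    by rewrite mxE !eqxx expr1n addr0 sqrtr1.
  by rewrite mxE (negbTE jn0) andbF expr0n.
have [c] := EVT_max_rV A0 cA (continuous_subspaceT cf).
rewrite inE => Ac cmax.
have vc : inj_values T (f c) by exists (X c) => //; exact: AX.
have ub : ubound (inj_values T) (f c).
  move=> _ [x /XA[v Av <-] ->]; apply: cmax; exact: mem_set.
suff -> : inj_norm T = f c by [].
apply/eqP; rewrite eq_le; apply/andP; split.
  by apply: ge_sup => //; exists (f c).
by apply: ub_le_sup => //; exists (f c).
Qed.

Definition tensor_sup_norm n r (T : tensor n r) : R :=
  \big[Num.max/0]_i `|T i|.

End Tensors.
Arguments tensor : clear implicits.

Section Random.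
Context {d : measure_display} {Omega : measurableType d} {R : realType}.
Variable P : probability Omega R.

Definition mutually_independent (I : finType) (X : I -> {RV P >-> R}) : Prop :=
  forall (J : {set I}) (A : I -> set R),
    (forall i, measurable (A i)) ->
    P (\bigcap_(i in [set` J]) (X i @^-1` A i)) =
    (\prod_(i in J) P (X i @^-1` A i))%E.

Variables n r : nat.

Definition sample (T : tensor_index n r -> {RV P >-> R}) (w : Omega) :
  tensor R n r := fun i => T i w.

(* For integrable entries 'E_P[T i] is finite and fine loses nothing. *)
Definition mean_tensor (T : tensor_index n r -> {RV P >-> R}) : tensor R n r :=
  fun i => fine 'E_P[T i].

Definition centered (T : tensor_index n r -> {RV P >-> R}) (w : Omega) :
  tensor R n r := fun i => sample T w i - mean_tensor T i.

End Random.

Definition Cconst (R : realType) (n r : nat) (eps : R) : R :=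
  if r%:R <= eps * ln n%:R / (5 * ln (ln n%:R)) then r%:R ^+ 4 / eps
  else r%:R ^+ 5 / eps ^+ 2 * ln (r%:R / eps) ^+ 2.

(* Main.v *)
Require Import Defs.
From HB Require Import structures.
From mathcomp Require Import all_boot all_order all_algebra.
From mathcomp Require Import all_classical all_reals all_analysis.
From mathcomp Require Import measurable_realfun ring lra zify.

(** A Kahn-Szemeredi type argument.  After rescaling by [M] and rounding, the
entries take finitely many values in [[-1, 1]], so that everything happens on a
finite product space; entries larger than [M] cost only [O(M)], since by
independence their total first moment is at most [2 E |T|_oo].

The injective norm is approximated by grid vectors [y_1, ..., y_r] of norm at
most 1.  Call an index [i] heavy when all [y_j(i_j)] are nonzero and
[prod_(l != j) y_l(i_l)^2 > rho ~ n^(-1 - eps/2)] for some [j].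
- On light indices the coefficient is at most [sqrt rho * min_j |y_j(i_j)|].
  Split them dyadically according to this minimum: at level [2^-s] only about
  [4^s] entries of each [y_j] matter, and the exponential moment of the centered
  sum beats the number of such vectors.
- On heavy indices centering is not needed: AM-GM bounds the coefficient by
  [(min_j y_j(i_j)^2 + sum_j prod_(l != j) y_l(i_l)^2) / 2].  The second part is
  controlled because every fiber has [O((L + r + t) / eps)] nonzero entries.
  For the first, with high probability the number of nonzero entries at the
  heavy indices of every grid vector is at most [K] times the size of its
  support; applying this to the truncations [y 1_{|y| > a}] and integrating over
  [a] gives [K sum_j |y_j|^2 <= K r]. *)

Set Implicit Arguments.
Unset Strict Implicit.
Unset Printing Implicit Defensive.
Import Order.TTheory GRing.Theory Num.Theory.
Import numFieldNormedType.Exports.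
Local Open Scope classical_set_scope.
Local Open Scope ring_scope.

Lemma ler_sum_card {R : numDomainType} (I : finType) (F : I -> R) (c : R) :
  (forall i, F i <= c) -> \sum_i F i <= #|I|%:R * c.
Proof. by move=> Fc; rewrite mulr_natl -sumr_const; exact: ler_sum. Qed.

Lemma le_staircase {R : realType} (a b x : R) (K : nat) :
  0 <= b -> x <= a + b * K.+1%:R ->
  x <= a + b + b * \sum_(k < K) (a + b * k.+1%:R < x)%R%:R.
Proof.
move=> b0; elim: K => [|K IH] xK.
  by rewrite big_ord0 mulr0 addr0 -[b in leRHS]mulr1.
rewrite big_ord_recr /=; have [xle|xgt] := leP x (a + b * K.+1%:R).
  by rewrite addr0 IH.
rewrite (eq_bigr (fun=> 1)) => [|k _].
  by rewrite sumr_const card_ord; move: xK; rewrite -!natr1; lra.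
by rewrite (le_lt_trans _ xgt)// lerD2l ler_wpM2l// ler_nat ltnS ltnW.
Qed.

(** * Finite probability spaces *)

Section FiniteProbability.
Context {R : realType} {F : finType}.
Implicit Types (w X Y : F -> R) (E : pred F).

Definition pmf w : Prop := (forall x, 0 <= w x) /\ \sum_x w x = 1.

Definition fmean w X : R := \sum_x w x * X x.

Definition fprob w E : R := \sum_(x | E x) w x.

Lemma fprob_fmean w E : fprob w E = fmean w (fun x => (E x)%:R).
Proof.
rewrite /fprob big_mkcond; apply: eq_bigr => x _.
by case: (E x); rewrite ?mulr1 ?mulr0.
Qed.

Lemma fmeanD w X Y : fmean w (fun x => X x + Y x) = fmean w X + fmean w Y.
Proof. by rewrite -big_split; apply: eq_bigr => x _; rewrite mulrDr. Qed.

Lemma fmeanZ w (c : R) X : fmean w (fun x => c * X x) = c * fmean w X.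
Proof. by rewrite mulr_sumr; apply: eq_bigr => x _; rewrite mulrCA. Qed.

Lemma fmean_sum w (J : finType) (X : J -> F -> R) :
  fmean w (fun x => \sum_j X j x) = \sum_j fmean w (X j).
Proof.
by rewrite exchange_big; apply: eq_bigr => x _; rewrite mulr_sumr.
Qed.

Variable w : F -> R.
Hypothesis pmf_w : pmf w.

Lemma fmean_cst (c : R) : fmean w (fun=> c) = c.
Proof. by rewrite /fmean -mulr_suml (proj2 pmf_w) mul1r. Qed.

Lemma le_fmean X Y : (forall x, X x <= Y x) -> fmean w X <= fmean w Y.
Proof. by move=> XY; apply: ler_sum => x _; rewrite ler_wpM2l// pmf_w.1. Qed.

Lemma ler_norm_fmean X : `|fmean w X| <= fmean w (fun x => `|X x|).
Proof.
apply: le_trans (ler_norm_sum _ _ _) _; apply: ler_sum => x _.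
by rewrite normrM (ger0_norm (pmf_w.1 x)).
Qed.

Lemma le_fprob E1 E2 : (forall x, E1 x -> E2 x) -> fprob w E1 <= fprob w E2.
Proof.
move=> E12; rewrite !fprob_fmean; apply: le_fmean => x; rewrite ler_nat.
by case: (boolP (E1 x)) => [/E12 ->|].
Qed.

Lemma fprob_or E1 E2 :
  fprob w (fun x => E1 x || E2 x) <= fprob w E1 + fprob w E2.
Proof.
rewrite !fprob_fmean -fmeanD; apply: le_fmean => x.
by rewrite -natrD ler_nat; case: (E1 x); case: (E2 x).
Qed.

Lemma fprob_exists (J : finType) (E : J -> pred F) :
  fprob w (fun x => [exists j, E j x]) <= \sum_j fprob w (E j).
Proof.
under eq_bigr do rewrite fprob_fmean.
rewrite -fmean_sum fprob_fmean; apply: le_fmean => x; rewrite -natr_sum ler_nat.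
by case: existsP => // -[j Ej]; rewrite (bigD1 j)//= Ej.
Qed.

Lemma fprob_andl_le (b : bool) E (c : R) : 0 <= c ->
  (b -> fprob w E <= c) -> fprob w (fun x => b && E x) <= c.
Proof.
by move=> c0; case: b => /=; [apply | move=> _; rewrite /fprob big_pred0].
Qed.

Lemma chernoff_bound X (u : R) :
  fprob w (fun x => u < X x) <= expR (- u) * fmean w (fun x => expR (X x)).
Proof.
rewrite fprob_fmean -fmeanZ; apply: le_fmean => x; rewrite -expRD.
case: ltP => [uX|_]; last exact: expR_ge0.
by rewrite -expR0 ler_expR addrC subr_ge0 ltW.
Qed.

Lemma fmean_le_geometric_tail X (a b : R) : 0 < b ->
  (forall k, fprob w (fun x => a + b * k.+1%:R < X x) <= 2^-1 ^+ k.+1) ->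
  fmean w X <= a + 2 * b.
Proof.
move=> b0 tail.
pose K := Num.truncn (\sum_x (`|X x| + `|a|) / b).
have XK x : X x <= a + b * K.+1%:R.
  rewrite -lerBlDl mulrC -ler_pdivrMr//.
  apply: le_trans (ltW (truncnS_gt _)).
  apply: (@le_trans _ _ ((`|X x| + `|a|) / b)).
    by rewrite ler_pM2r ?invr_gt0// -[`|a|]normrN lerD// ler_norm.
  rewrite (bigD1 x)//= lerDl sumr_ge0// => y _.
  by rewrite divr_ge0 ?addr_ge0// ltW.
apply: le_trans (le_fmean (fun x => le_staircase (ltW b0) (XK x))) _.
rewrite fmeanD fmean_cst fmeanZ fmean_sum -addrA mulr2n mulrDl mul1r !lerD2l.
rewrite ler_piMr ?(ltW b0)//.
under eq_bigr do rewrite -fprob_fmean.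
apply: le_trans (ler_sum _ (fun (k : 'I_K) _ => tail k)) _.
under eq_bigr do rewrite exprS.
have half : `|2^-1| < 1 :> R by rewrite ger0_norm ?invr_ge0// invf_lt1// ltr1n.
apply: le_trans (_ : series (geometric 2^-1 2^-1) K <= 1).
  by rewrite /series /= big_mkord.
apply: le_trans (geometric_le_lim _ _ _ half) _; rewrite ?invr_ge0//.
by rewrite [leLHS](_ : _ = 1)//; field.
Qed.

End FiniteProbability.

Section ProductProbability.
Context {R : realType} (I V : finType) (mu : I -> V -> R).

Definition prod_pmf (f : {ffun I -> V}) : R := \prod_i mu i (f i).

Lemma fmean_prod (phi : I -> V -> R) :
  fmean prod_pmf (fun f => \prod_i phi i (f i)) = \prod_i fmean (mu i) (phi i).
Proof.
by rewrite bigA_distr_bigA; apply: eq_bigr => f _; rewrite -big_split.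
Qed.

Hypothesis pmf_mu : forall i, pmf (mu i).

Lemma pmf_prod : pmf prod_pmf.
Proof.
split=> [f|]; first by apply: prodr_ge0 => i _; apply: (pmf_mu i).1.
by rewrite -(bigA_distr_bigA mu) big1 // => i _; case: (pmf_mu i).
Qed.

Lemma chernoff_bound_prod (phi : I -> V -> R) (b : I -> R) (u : R) :
  (forall i, fmean (mu i) (fun v => expR (phi i v)) <= expR (b i)) ->
  fprob prod_pmf (fun f => u < \sum_i phi i (f i)) <= expR (\sum_i b i - u).
Proof.
move=> mgf; apply: le_trans (chernoff_bound pmf_prod _ _) _.
rewrite addrC expRD ler_pM2l ?expR_gt0// expR_sum.
under [X in fmean _ X]eq_fun do rewrite expR_sum.
rewrite (fmean_prod (fun i v => expR (phi i v))); apply: ler_prod => i _.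
rewrite mgf andbT sumr_ge0// => v _.
by rewrite mulr_ge0 ?expR_ge0 ?(pmf_mu i).1.
Qed.

End ProductProbability.

Lemma expR_le_quadratic {R : realType} (y : R) :
  y <= 1 / 2 -> expR y <= 1 + y + 2 * y ^+ 2.
Proof.
move=> y2; have ey := expR_ge1Dx (- y).
rewrite -[y in expR y]opprK expRN -[leRHS]invrK.
have quad_gt0 : 0 < 1 + y + 2 * y ^+ 2 by nra.
rewrite lef_pV2 ?posrE ?expR_gt0 ?invr_gt0//.
by apply: le_trans ey; rewrite -div1r ler_pdivrMr//; nra.
Qed.

Section SparseVariable.
Context {R : realType} (V : finType) (mu X : V -> R) (p : R).
Hypothesis pmf_mu : pmf mu.
Hypothesis sparse_mu : fprob mu (fun v => X v != 0) <= p.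

Lemma mgf_neq0_le (a : R) : 0 <= a ->
  fmean mu (fun v => expR (a * (X v != 0)%:R)) <= expR (p * expR a).
Proof.
move=> a0; apply: le_trans (expR_ge1Dx _).
have expa1 : 0 <= expR a - 1 by rewrite subr_ge0 -expR0 ler_expR.
apply: (@le_trans _ _ (fmean mu (fun v => 1 + (expR a - 1) * (X v != 0)%:R))).
  apply: le_fmean => // v.
  by case: (X v != 0); rewrite ?mulr1 ?mulr0 ?expR0; lra.
rewrite fmeanD fmean_cst// fmeanZ -fprob_fmean lerD2l mulrC.
have p0 : 0 <= p.
  by apply: le_trans sparse_mu; apply: sumr_ge0 => v _; case: pmf_mu.
by apply: le_trans (ler_wpM2r expa1 sparse_mu) _; rewrite ler_wpM2l// gerBl.
Qed.

Hypothesis X_le1 : forall v, `|X v| <= 1.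

Lemma fmean_le_sparse (Y : V -> R) : (forall v, Y v <= (X v != 0)%:R) ->
  fmean mu Y <= p.
Proof.
move=> YX; apply: le_trans sparse_mu; rewrite fprob_fmean.
exact: le_fmean.
Qed.

Lemma norm_fmean_le_sparse : `|fmean mu X| <= p.
Proof.
apply: le_trans (ler_norm_fmean pmf_mu _) _; apply: fmean_le_sparse => v.
by case: eqP => [->|_]; rewrite ?normr0 ?X_le1.
Qed.

Lemma norm_fmean_le1 : `|fmean mu X| <= 1.
Proof.
apply: le_trans (ler_norm_fmean pmf_mu _) _.
by rewrite -[leRHS](fmean_cst pmf_mu 1); apply: le_fmean.
Qed.

Lemma fmean_sub_fmean : fmean mu (fun v => X v - fmean mu X) = 0.
Proof. by rewrite fmeanD fmean_cst// subrr. Qed.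

Lemma variance_le_sparse : fmean mu (fun v => (X v - fmean mu X) ^+ 2) <= p.
Proof.
have -> : (fun v => (X v - fmean mu X) ^+ 2) =
    (fun v => X v ^+ 2 + (- (2 * fmean mu X) * X v + fmean mu X ^+ 2)).
  by apply/funext => v; ring.
rewrite !fmeanD fmeanZ fmean_cst//.
apply: (@le_trans _ _ (fmean mu (fun v => X v ^+ 2))).
  by have := sqr_ge0 (fmean mu X); lra.
apply: fmean_le_sparse => v; case: eqP => [->|_]; first by rewrite expr0n.
by rewrite -real_normK ?num_real// expr_le1.
Qed.

Lemma mgf_centered_le (c : R) : `|c| <= 1 / 4 ->
  fmean mu (fun v => expR (c * (X v - fmean mu X))) <= expR (2 * c ^+ 2 * p).
Proof.
move=> c4; apply: le_trans (expR_ge1Dx _).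
pose Y v := X v - fmean mu X.
apply: (@le_trans _ _
    (fmean mu (fun v => 1 + (c * Y v + 2 * c ^+ 2 * Y v ^+ 2)))).
  apply: le_fmean => // v; have -> : 1 + (c * Y v + 2 * c ^+ 2 * Y v ^+ 2) =
      1 + c * Y v + 2 * (c * Y v) ^+ 2 by ring.
  apply: expR_le_quadratic; apply: le_trans (ler_norm _) _; rewrite normrM.
  have Y2 : `|Y v| <= 2.
    apply: le_trans (ler_normB _ _) _.
    by have := X_le1 v; have := norm_fmean_le1; lra.
  by have := normr_ge0 c; nra.
rewrite !fmeanD !fmeanZ fmean_cst// fmean_sub_fmean mulr0 add0r lerD2l.
by rewrite ler_wpM2l ?variance_le_sparse// mulr_ge0 ?sqr_ge0.
Qed.

End SparseVariable.

Section SparseFamily.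
Context {R : realType} (I V : finType) (mu : I -> V -> R) (X : V -> R) (p : R).
Hypothesis pmf_mu : forall i, pmf (mu i).
Hypothesis sparse_mu : forall i, fprob (mu i) (fun v => X v != 0) <= p.

Definition nonzero_count (A : pred I) (f : {ffun I -> V}) : R :=
  \sum_(i | A i) (X (f i) != 0)%:R.

Lemma nonzero_count_tail (A : pred I) (a c : R) : 0 < a ->
  fprob (prod_pmf mu) (fun f => c < nonzero_count A f) <=
  expR (#|A|%:R * (p * expR a) - a * c).
Proof.
move=> a0.
pose phi i v : R := if A i then a * (X v != 0)%:R else 0.
pose b i : R := if A i then p * expR a else 0.
have mgf i : fmean (mu i) (fun v => expR (phi i v)) <= expR (b i).
  rewrite /phi /b; case: (A i); first exact: mgf_neq0_le (ltW a0).
  by rewrite fmean_cst// expR0.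
apply: le_trans (le_fprob (pmf_prod pmf_mu) _)
  (le_trans (chernoff_bound_prod pmf_mu (a * c) mgf) _).
- by move=> f; rewrite -(ltr_pM2l a0) mulr_sumr /phi big_mkcond.
- by rewrite /b -big_mkcond sumr_const mulr_natl.
Qed.

Hypothesis X_le1 : forall v, `|X v| <= 1.

Definition centered_family (f : {ffun I -> V}) (i : I) : R :=
  X (f i) - fmean (mu i) X.

Lemma norm_centered_family_le f i :
  `|centered_family f i| <= (X (f i) != 0)%:R + p.
Proof.
apply: le_trans (ler_normB _ _) _; apply: lerD.
  by case: eqP => [->|_]; rewrite ?normr0.
exact: norm_fmean_le_sparse.
Qed.

Lemma norm_centered_family_le2 f i : `|centered_family f i| <= 2.
Proof.
apply: le_trans (ler_normB _ _) _; have := X_le1 (f i).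
by have := norm_fmean_le1 (pmf_mu i) X_le1; lra.
Qed.

Lemma linear_form_upper_tail (c : I -> R) (a u : R) : 0 <= p -> 0 < a ->
  (forall i, a * `|c i| <= 1 / 4) -> \sum_i c i ^+ 2 <= 1 ->
  fprob (prod_pmf mu) (fun f => u < \sum_i centered_family f i * c i) <=
  expR (2 * a ^+ 2 * p - a * u).
Proof.
move=> p0 a0 ac c1.
have mgf i : fmean (mu i) (fun v => expR (a * c i * (X v - fmean (mu i) X))) <=
    expR (2 * (a * c i) ^+ 2 * p).
  by apply: mgf_centered_le => //; rewrite normrM gtr0_norm.
apply: le_trans (le_fprob (pmf_prod pmf_mu) _)
  (le_trans (chernoff_bound_prod pmf_mu (a * u) mgf) _).
- move=> f; rewrite -(ltr_pM2l a0) mulr_sumr => /lt_le_trans; apply.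
  by apply: ler_sum => i _; rewrite mulrA mulrAC.
- rewrite ler_expR lerD2r -mulr_suml -mulr_sumr.
  under eq_bigr do rewrite exprMn.
  by rewrite -mulr_sumr ler_wpM2r// ler_wpM2l// ler_piMr// sqr_ge0.
Qed.

Lemma linear_form_tail (c : I -> R) (a u : R) : 0 <= p -> 0 < a ->
  (forall i, a * `|c i| <= 1 / 4) -> \sum_i c i ^+ 2 <= 1 ->
  fprob (prod_pmf mu) (fun f => u < `|\sum_i centered_family f i * c i|) <=
  2 * expR (2 * a ^+ 2 * p - a * u).
Proof.
move=> p0 a0 ac c1; rewrite mulr_natl mulr2n.
have upper := linear_form_upper_tail u p0 a0 ac c1.
have lower : fprob (prod_pmf mu)
    (fun f => u < \sum_i centered_family f i * (- c i)) <=
    expR (2 * a ^+ 2 * p - a * u).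
  apply: linear_form_upper_tail => // [i|]; first by rewrite normrN.
  by under eq_bigr do rewrite sqrrN.
apply: le_trans (lerD upper lower).
apply: le_trans (fprob_or (pmf_prod pmf_mu) _ _).
apply: (le_fprob (pmf_prod pmf_mu)) => f; rewrite ltr_normr => /orP[->//|uf].
by under [in X in _ || X]eq_bigr do rewrite mulrN; rewrite sumrN uf orbT.
Qed.

End SparseFamily.

(** * Grid vectors: light and heavy indices *)

Section Truncation.
Context {R : realType}.
Implicit Types y : R.

Definition trunc0 y : R := (Num.truncn y)%:R - (Num.truncn (- y))%:R.

Lemma truncn_le0 y : y <= 0 -> Num.truncn y = 0%N.
Proof. by move=> y0; apply/truncn0Pn; rewrite -ltNge (le_lt_trans y0). Qed.

Lemma trunc0N y : trunc0 (- y) = - trunc0 y.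
Proof. by rewrite /trunc0 opprK opprB. Qed.

Lemma trunc0P y : `|trunc0 y| <= `|y| /\ `|y - trunc0 y| <= 1.
Proof.
wlog y0 : y / 0 <= y => [pos|].
  have [/pos//|/ltW y0] := leP 0 y.
  have := pos (- y); rewrite trunc0N -opprD !normrN; apply.
  by rewrite oppr_ge0.
have /andP[ty yt] := truncn_itv y0; rewrite -natr1 in yt.
rewrite /trunc0 (@truncn_le0 (- y)) ?oppr_le0// subr0 !ger0_norm// ?subr_ge0//.
by split=> //; lra.
Qed.

End Truncation.

Section Grid.
Context {R : realType} (m : nat).

(* The index [g] stands for the point [(g - m) / m] of [[-1, 1]]. *)
Definition gval (g : 'I_(2 * m).+1) : R := (g%:R - m%:R) / m%:R.

Definition mag (g : 'I_(2 * m).+1) : nat := (g - m + (m - g))%N.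

Definition gzero : 'I_(2 * m).+1 := inord m.

Lemma gzeroE : gzero = m :> nat. Proof. by rewrite inordK//; lia. Qed.

Lemma mag_gzero : mag gzero = 0%N. Proof. by rewrite /mag gzeroE; lia. Qed.

Lemma mag_le g : (mag g <= m)%N.
Proof. by have := ltn_ord g; rewrite /mag; lia. Qed.

Hypothesis m_gt0 : (0 < m)%N.

Let mR_gt0 : 0 < m%:R :> R. Proof. by rewrite ltr0n. Qed.

Lemma norm_gval g : `|gval g| = (mag g)%:R / m%:R.
Proof.
rewrite /gval /mag normrM normfV [`|m%:R|]ger0_norm//; congr (_ / _).
case: (leqP m g) => mg.
  by rewrite ger0_norm ?subr_ge0 ?ler_nat// natrD natrB// (eqP mg) addr0.
rewrite ltr0_norm ?subr_lt0 ?ltr_nat// natrD (natrB _ (ltnW mg)) opprB.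
by rewrite (eqP (ltnW mg)) add0r.
Qed.

Lemma gval_sqr g : gval g ^+ 2 = (mag g ^ 2)%:R / m%:R ^+ 2.
Proof. by rewrite -[LHS]real_normK ?num_real// norm_gval expr_div_n natrX. Qed.

Lemma gval_le1 g : `|gval g| <= 1.
Proof. by rewrite norm_gval ler_pdivrMr// mul1r ler_nat mag_le. Qed.

Lemma gval_eq0 g : (gval g == 0) = (mag g == 0%N).
Proof.
rewrite -normr_eq0 norm_gval mulf_eq0 invr_eq0 (gt_eqF mR_gt0) orbF.
by rewrite pnatr_eq0.
Qed.

Definition gtrunc (x : R) : 'I_(2 * m).+1 :=
  inord (m + Num.truncn (m%:R * x) - Num.truncn (- (m%:R * x))).

Lemma truncn_le_resolution (x : R) : `|x| <= 1 ->
  (Num.truncn (m%:R * x) <= m)%N.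
Proof.
move=> /ler_normlP[_ x1]; rewrite truncn_le_nat -natr1.
by have := mR_gt0; nra.
Qed.

Lemma gtrunc_homo (x y : R) : `|x| <= 1 -> `|y| <= 1 -> x <= y ->
  (gtrunc x <= gtrunc y)%N.
Proof.
move=> /truncn_le_resolution x1 /truncn_le_resolution y1 xy.
rewrite /gtrunc !inordK ?ltnS; [|by lia..].
apply: leq_sub; rewrite ?leq_add2l; apply: le_truncn.
  by rewrite ler_pM2l.
by rewrite lerN2 ler_pM2l.
Qed.

Lemma gval_gtrunc (x : R) : `|x| <= 1 ->
  gval (gtrunc x) = trunc0 (m%:R * x) / m%:R.
Proof.
move=> x1; have tx := truncn_le_resolution x1.
have tNx : (Num.truncn (- (m%:R * x)) <= m)%N.
  by rewrite -mulrN truncn_le_resolution// normrN.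
rewrite /gval /gtrunc /trunc0 inordK; last by lia.
by rewrite natrB ?natrD; [congr (_ / _); ring | lia].
Qed.

Lemma gtruncP (x : R) : `|x| <= 1 ->
  `|gval (gtrunc x)| <= `|x| /\ `|x - gval (gtrunc x)| <= m%:R^-1.
Proof.
move=> x1; rewrite gval_gtrunc//; have [] := trunc0P (m%:R * x).
move: (trunc0 _) => t tle tdist.
have xE : x = m%:R * x / m%:R by rewrite mulrC mulKf ?gt_eqF.
rewrite [x in X in _ /\ X]xE -mulrBl !normrM normfV [`|m%:R|]gtr0_norm//.
rewrite ler_piMl ?invr_ge0 ?ler0n// ler_pdivrMr//; split=> //.
by rewrite -[X in _ * X]gtr0_norm// -normrM mulrC.
Qed.

End Grid.

Section GridTuples.
Context {R : realType} (n r m : nat).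
Hypotheses (m_gt0 : (0 < m)%N) (r_gt0 : (0 < r)%N).

Definition grid : finType := {ffun 'I_r * 'I_n -> 'I_(2 * m).+1}.

Implicit Types (z : grid) (i : tensor_index n r) (j : 'I_r) (c : pred nat).

Definition in_ball z :=
  [forall j, (\sum_(v < n) mag (z (j, v)) ^ 2 <= m ^ 2)%N].

Definition supp z : {set 'I_r * 'I_n} := [set q | mag (z q) != 0%N].

Definition restrict c z : grid :=
  [ffun q => if c (mag (z q)) then z q else gzero m].

Definition coef z : tensor R n r := fun i => \prod_j gval (z (j, i j)).

Definition cofac z i j : R := \prod_(l | l != j) gval (z (l, i l)) ^+ 2.

Definition minmag z i : nat := \big[minn/m]_j mag (z (j, i j)).

Definition heavy (rho : R) z i :=
  (0 < minmag z i)%N && [exists j, rho < cofac z i j].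

Let mR_gt0 : 0 < m%:R :> R. Proof. by rewrite ltr0n. Qed.

Lemma mag_restrict c z q :
  mag (restrict c z q) = if c (mag (z q)) then mag (z q) else 0%N.
Proof. by rewrite ffunE; case: ifP => // _; rewrite mag_gzero. Qed.

Lemma in_ball_restrict c z : in_ball z -> in_ball (restrict c z).
Proof.
move=> /forallP bz; apply/forallP => j; apply: leq_trans (bz j).
by apply: leq_sum => v _; rewrite mag_restrict; case: ifP.
Qed.

Lemma restrict_id c z i : (forall j, c (mag (z (j, i j)))) ->
  forall j, restrict c z (j, i j) = z (j, i j).
Proof. by move=> cz j; rewrite ffunE cz. Qed.

Lemma eq_coef z1 z2 i : (forall j, z1 (j, i j) = z2 (j, i j)) ->
  coef z1 i = coef z2 i.
Proof. by move=> e; apply: eq_bigr => j _; rewrite e. Qed.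

Lemma eq_minmag z1 z2 i : (forall j, z1 (j, i j) = z2 (j, i j)) ->
  minmag z1 i = minmag z2 i.
Proof. by move=> e; apply: eq_bigr => j _; rewrite e. Qed.

Lemma eq_heavy rho z1 z2 i : (forall j, z1 (j, i j) = z2 (j, i j)) ->
  heavy rho z1 i = heavy rho z2 i.
Proof.
move=> e; rewrite /heavy (eq_minmag e); congr andb.
by apply: eq_existsb => j; congr (_ < _); apply: eq_bigr => l _; rewrite e.
Qed.

Lemma ltn_minmag a z i : (a < minmag z i)%N =
  (a < m)%N && [forall j, (a < mag (z (j, i j)))%N].
Proof.
have -> : [forall j, (a < mag (z (j, i j)))%N] =
    \big[andb/true]_j (a < mag (z (j, i j)))%N.
  by rewrite big_andE; apply: eq_forallb.
rewrite /minmag; elim/big_rec2: _ => [|j b k _ IH]; first by rewrite andbT.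
by rewrite leq_min IH andbCA.
Qed.

Lemma minmag_le z i j : (minmag z i <= mag (z (j, i j)))%N.
Proof.
rewrite leqNgt; apply/negP; rewrite ltn_minmag => /andP[_ /forallP/(_ j)].
by rewrite ltnn.
Qed.

Lemma minmag_le_resolution z i : (minmag z i <= m)%N.
Proof. by rewrite leqNgt ltn_minmag ltnn. Qed.

Lemma minmag_attained z i : exists j, minmag z i = mag (z (j, i j)).
Proof.
suff [j mj] : exists j, (mag (z (j, i j)) <= minmag z i)%N.
  by exists j; apply/eqP; rewrite eqn_leq minmag_le.
have := ltnn (minmag z i); rewrite [X in X = _]ltn_minmag.
case: (ltnP (minmag z i) m) => [_|mm _] /=.
  by move/negbT; rewrite negb_forall => /existsP[j]; rewrite -leqNgt; exists j.
by exists (Ordinal r_gt0); apply: leq_trans mm; exact: mag_le.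
Qed.

Lemma minmag_supp z i j : (0 < minmag z i)%N -> (j, i j) \in supp z.
Proof. by move=> z0; rewrite inE -lt0n (leq_trans z0)// minmag_le. Qed.

Lemma coef_minmag0 z i : minmag z i = 0%N -> coef z i = 0.
Proof.
have [j ->] := minmag_attained z i => m0.
by apply/eqP/prodf_eq0; exists j => //; rewrite gval_eq0// m0.
Qed.

Lemma cofac_ge0 z i j : 0 <= cofac z i j.
Proof. by apply: prodr_ge0 => l _; exact: sqr_ge0. Qed.

Lemma coef_sqr z i j : coef z i ^+ 2 = gval (z (j, i j)) ^+ 2 * cofac z i j.
Proof.
by rewrite /coef (bigD1 j)//= exprMn; congr (_ * _); rewrite -prodrXl.
Qed.

(* AM-GM, singling out the coordinate of least magnitude. *)
Lemma norm_coef_le z i :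
  `|coef z i| <= (((minmag z i)%:R / m%:R) ^+ 2 + \sum_j cofac z i j) / 2.
Proof.
have [j mj] := minmag_attained z i.
have cofac_le_sum : cofac z i j <= \sum_l cofac z i l.
  by rewrite (bigD1 j)//= lerDl; apply: sumr_ge0 => l _; exact: cofac_ge0.
rewrite mj -norm_gval real_normK ?num_real//.
apply: (@le_trans _ _ ((gval (z (j, i j)) ^+ 2 + cofac z i j) / 2));
  last by lra.
rewrite -ler_sqr ?nnegrE ?divr_ge0 ?addr_ge0 ?sqr_ge0 ?cofac_ge0//.
by rewrite real_normK ?num_real// (coef_sqr _ _ j) leif_AGM2.
Qed.

Lemma sum_gval_sqr_le1 z j : in_ball z ->
  \sum_(v < n) gval (z (j, v)) ^+ 2 <= 1 :> R.
Proof.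
move=> /forallP/(_ j) bz; under eq_bigr do rewrite gval_sqr.
by rewrite -mulr_suml -natr_sum ler_pdivrMr ?exprn_gt0// mul1r -natrX ler_nat.
Qed.

Lemma sum_coef_sqr_le1 z : in_ball z -> \sum_i coef z i ^+ 2 <= 1.
Proof.
move=> bz; under eq_bigr do rewrite -prodrXl.
rewrite -(bigA_distr_bigA (fun j v => gval (z (j, v)) ^+ 2)) /=.
apply: prodr_ile1 => j _; rewrite sum_gval_sqr_le1 ?andbT//.
by apply: sumr_ge0 => v _; exact: sqr_ge0.
Qed.

Lemma sum_cofac_le1 z j (v : 'I_n) : in_ball z ->
  \sum_(i : tensor_index n r | i j == v) cofac z i j <= 1.
Proof.
move=> bz.
pose F l u : R := if l == j then (u == v)%:R else gval (z (l, u)) ^+ 2.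
have -> : \sum_(i : tensor_index n r | i j == v) cofac z i j =
    \sum_(i : tensor_index n r) \prod_l F l (i l).
  rewrite big_mkcond; apply: eq_bigr => i _.
  rewrite [RHS](bigD1 j)//= {1}/F eqxx.
  case: ifPn => _; last by rewrite mul0r.
  by rewrite mul1r; apply: eq_bigr => l lj; rewrite /F (negbTE lj).
rewrite -(bigA_distr_bigA F) /=.
apply: prodr_ile1 => l _; rewrite /F; case: eqP => _.
  by rewrite (bigD1 v)//= eqxx big1 ?addr0 ?lexx ?ler01// => u /negbTE ->.
rewrite sum_gval_sqr_le1 ?andbT//.
by apply: sumr_ge0 => u _; exact: sqr_ge0.
Qed.

(* Charge a heavy [i] to a support point [(j, i j)] with [rho < cofac z i j]. *)
Lemma card_heavy_le rho z : 0 < rho -> in_ball z ->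
  #|heavy rho z|%:R <= #|supp z|%:R / rho.
Proof.
move=> rho0 bz.
apply: (@le_trans _ _ (\sum_(q in supp z)
    \sum_(i : tensor_index n r | i q.1 == q.2) cofac z i q.1 / rho));
  last first.
  rewrite -sum1_card natr_sum mulr_suml; apply: ler_sum => -[j v] _ /=.
  by rewrite -mulr_suml ler_wpM2r ?invr_ge0 ?(ltW rho0)// sum_cofac_le1.
rewrite -sum1_card natr_sum.
under [leRHS]eq_bigr do rewrite big_mkcond /=.
rewrite [leRHS]exchange_big big_mkcond /=; apply: ler_sum => i _.
have charge_ge0 q : 0 <= if i q.1 == q.2 then cofac z i q.1 / rho else 0.
  by case: ifP => // _; rewrite divr_ge0 ?cofac_ge0 ?(ltW rho0).
case: ifPn => [/andP[mi /existsP[j hj]]|_]; last exact: sumr_ge0.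
rewrite (bigD1 (j, i j)) ?minmag_supp//= eqxx -[leLHS]addr0.
apply: lerD; last exact: sumr_ge0.
by rewrite ler_pdivlMr// mul1r (ltW hj).
Qed.

Lemma heavy_supp0 rho z i : #|supp z| = 0%N -> heavy rho z i = false.
Proof.
move=> /card0_eq z0; apply/negP => /andP[mi _].
by have := minmag_supp (Ordinal r_gt0) mi; rewrite z0.
Qed.

Lemma sqr_layer_cake k : (k <= m)%N ->
  (k ^ 2 = \sum_(a < m) (2 * a + 1) * (a < k))%N.
Proof.
move=> km; rewrite -(subnKC km) big_split_ord /=.
rewrite [X in (_ + X)%N]big1 ?addn0 => [|a _]; last first.
  by rewrite ltnNge leq_addr muln0.
under eq_bigr => a _ do rewrite ltn_ord muln1.
by elim: k {km} => [|k IH]; rewrite ?big_ord0// big_ord_recr /= -IH; lia.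
Qed.

Lemma heavy_restrict rho z i a : heavy rho z i -> (a < minmag z i)%N ->
  heavy rho (restrict (ltn a) z) i.
Proof.
move=> hz; rewrite ltn_minmag => /andP[_ /forallP az].
by rewrite (eq_heavy rho (restrict_id (c := ltn a) az)).
Qed.

Lemma sum_card_supp_restrict z : in_ball z ->
  (\sum_(a < m) (2 * a + 1) * #|supp (restrict (ltn a) z)| <= r * m ^ 2)%N.
Proof.
move=> bz.
have suppE a : #|supp (restrict (ltn a) z)| = (\sum_q (a < mag (z q))%N)%N.
  rewrite -sum1_card big_mkcond /=; apply: eq_bigr => q _.
  rewrite inE mag_restrict /=; case: ltnP => // az.
  by rewrite -lt0n (leq_ltn_trans _ az).
under eq_bigr do rewrite suppE big_distrr /=.
rewrite exchange_big /=; under eq_bigr do rewrite -sqr_layer_cake ?mag_le//.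
rewrite (eq_bigr (fun q => mag (z (q.1, q.2)) ^ 2)%N) => [|[] //].
rewrite -(pair_bigA _ (fun j v => mag (z (j, v)) ^ 2)%N) /=.
rewrite -[X in (_ <= X * _)%N]card_ord -sum_nat_const; apply: leq_sum => j _.
by move/forallP: bz; apply.
Qed.

(* Layer cake over the level sets of the minimal magnitude. *)
Lemma heavy_minmag_sum_le rho (b : tensor_index n r -> R) (K : R) z : 0 <= K ->
  (forall i, 0 <= b i) ->
  (forall z', in_ball z' ->
     \sum_(i | heavy rho z' i) b i <= K * #|supp z'|%:R) ->
  in_ball z ->
  \sum_(i | heavy rho z i) b i * ((minmag z i)%:R / m%:R) ^+ 2 <= K * r%:R.
Proof.
move=> K0 b0 bK bz.
under eq_bigr do
  rewrite expr_div_n mulrA -natrX sqr_layer_cake ?minmag_le_resolution//.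
rewrite -mulr_suml ler_pdivrMr ?exprn_gt0//.
under eq_bigr do rewrite natr_sum mulr_sumr.
rewrite exchange_big /=.
apply: (@le_trans _ _
    (\sum_(a < m) (2 * a + 1)%:R * (K * #|supp (restrict (ltn a) z)|%:R))).
  apply: ler_sum => a _; under eq_bigr do rewrite natrM mulrCA.
  rewrite -mulr_sumr ler_wpM2l//.
  apply: le_trans (bK _ (in_ball_restrict (ltn a) bz)).
  rewrite big_mkcond [leRHS]big_mkcond; apply: ler_sum => i _.
  case: ifPn => hz; last by case: ifPn.
  case: (ltnP a (minmag z i)) => [az|_].
    by rewrite heavy_restrict// mulr1.
  by rewrite mulr0; case: ifP.
under eq_bigr do rewrite mulrCA -natrM.
rewrite -mulr_sumr -mulrA ler_wpM2l// -natr_sum -natrX -natrM ler_nat.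
exact: sum_card_supp_restrict.
Qed.

End GridTuples.

Section LightHeavy.
Context {R : realType} (n r m : nat).
Hypotheses (m_gt0 : (0 < m)%N) (r_gt0 : (0 < r)%N) (n_gt0 : (0 < n)%N).
Implicit Types (z : grid n r m) (i : tensor_index n r) (j : 'I_r).
Implicit Types (x : tensor R n r) (b : tensor_index n r -> R) (rho : R).

Definition reset j i : tensor_index n r :=
  [ffun l => if l == j then Ordinal n_gt0 else i l].

(* The indices that agree with [i'] off the coordinate [j], provided that [i' j]
   is [0]; the fiber is empty otherwise. *)
Definition fiber j i' : pred (tensor_index n r) := fun i => reset j i == i'.

Lemma card_fiber j i' : (#|fiber j i'| <= n)%N.
Proof.
rewrite -[leqRHS]card_ord.
pose coordinate (i : tensor_index n r) := i j.
rewrite -(card_in_imset (f := coordinate) (D := fiber j i')).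
  exact: max_card.
move=> i1 i2 /eqP <- /eqP e ij; apply/ffunP => l.
by have /ffunP/(_ l) := e; rewrite !ffunE; case: eqP => [->|_ ->].
Qed.

Lemma fiber_cofac_sum_le b (k : R) z j : 0 <= k ->
  (forall i', \sum_(i | fiber j i' i) b i <= k) -> in_ball z ->
  \sum_i b i * cofac z i j <= k.
Proof.
move=> k0 bk bz.
rewrite (partition_big (reset j) (fun i' => i' j == Ordinal n_gt0)) /=;
  last by move=> i _; rewrite ffunE eqxx.
apply: (@le_trans _ _
    (\sum_(i' : tensor_index n r | i' j == Ordinal n_gt0) k * cofac z i' j)).
  apply: ler_sum => i' _; rewrite (eq_bigr (fun i => b i * cofac z i' j)).
    by rewrite -mulr_suml ler_wpM2r ?cofac_ge0//; exact: bk.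
  move=> i /eqP <-; congr (_ * _); apply: eq_bigr => l lj.
  by rewrite ffunE (negbTE lj).
by rewrite -mulr_sumr ler_piMr// sum_cofac_le1.
Qed.

Lemma heavy_form_le rho (K k : R) x b z : 0 <= K -> 0 <= k ->
  (forall i, `|x i| <= b i) ->
  (forall z', in_ball z' ->
     \sum_(i | heavy rho z' i) b i <= K * #|supp z'|%:R) ->
  (forall j i', \sum_(i | fiber j i' i) b i <= k) ->
  in_ball z ->
  `|\sum_(i | heavy rho z i) x i * coef z i| <= r%:R * (K + k) / 2.
Proof.
move=> K0 k0 xb heavyK fiberk bz.
have b0 i : 0 <= b i by apply: le_trans (xb i).
apply: le_trans (ler_norm_sum _ _ _) _.
pose minsqr i : R := ((minmag z i)%:R / m%:R) ^+ 2.
apply: (@le_trans _ _ ((\sum_(i | heavy rho z i) b i * minsqr i +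
    \sum_j \sum_i b i * cofac z i j) / 2)).
  rewrite mulrDl exchange_big /= [X in _ + X]mulr_suml.
  apply: (@le_trans _ _ (\sum_(i | heavy rho z i)
      (b i * minsqr i / 2 + (\sum_j b i * cofac z i j) / 2))).
    apply: ler_sum => i _; rewrite normrM -mulr_sumr -mulrDl -mulrDr -mulrA.
    by rewrite ler_pM ?norm_coef_le.
  rewrite big_split /= -mulr_suml lerD2l [leRHS](bigID (heavy rho z)) /= lerDl.
  apply: sumr_ge0 => i _; rewrite divr_ge0//; apply: sumr_ge0 => j _.
  by rewrite mulr_ge0 ?cofac_ge0.
rewrite ler_wpM2r ?invr_ge0// mulrDr lerD//.
  by rewrite mulrC; exact: heavy_minmag_sum_le.
by rewrite -[r in leRHS]card_ord ler_sum_card// => j; exact: fiber_cofac_sum_le.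
Qed.

(* On level [s] the least coordinate of [i] is about [2 ^- s]; the last level
   [S] collects all the smaller ones. *)
Definition level (S : nat) z i : nat := minn S (trunc_log 2 (m %/ minmag z i)).

Definition light (rho : R) (S : nat) z (s : nat) : tensor R n r :=
  fun i => if ~~ heavy rho z i && (level S z i == s) then coef z i else 0.

(* The magnitudes that the coordinates of an index of level [s] can have. *)
Definition kept (S s a : nat) : bool := (s == S) || (m < a * 2 ^ s.+1)%N.

Lemma norm_light_le (tau : R) S z s i : 0 <= tau ->
  `|light (tau ^+ 2) S z s i| <= tau / 2 ^+ s.
Proof.
move=> tau0; have bound_ge0 : 0 <= tau / 2 ^+ s by rewrite divr_ge0 ?exprn_ge0.
rewrite /light; case: ifPn => [/andP[nh /eqP ls]|_]; last by rewrite normr0.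
case: (posnP (minmag z i)) => [z0|zp]; first by rewrite coef_minmag0 ?normr0.
have [j mj] := minmag_attained r_gt0 z i.
move: nh; rewrite negb_and zp /= negb_exists => /forallP/(_ j).
rewrite -leNgt => cofac_le.
rewrite -ler_sqr ?nnegrE// real_normK ?num_real// (coef_sqr z i j).
rewrite [(tau / _) ^+ 2]expr_div_n mulrC ler_pM ?cofac_ge0 ?sqr_ge0//.
have level_le : (2 ^ s * minmag z i <= m)%N.
  rewrite -leq_divRL//; apply: (@leq_trans (2 ^ trunc_log 2 (m %/ minmag z i))).
    by rewrite leq_pexp2l// -ls geq_minr.
  by rewrite trunc_logP// divn_gt0// minmag_le_resolution.
rewrite -[leLHS]real_normK ?num_real// norm_gval// -mj -exprVn.
rewrite ler_sqr ?nnegrE ?divr_ge0 ?invr_ge0 ?exprn_ge0//.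
rewrite ler_pdivrMr ?ltr0n// ler_pdivlMl ?exprn_gt0//.
by rewrite -natrX -natrM ler_nat.
Qed.

Lemma light_restrict rho S z s : (s <= S)%N ->
  light rho S (restrict (kept S s) z) s = light rho S z s.
Proof.
move=> sS; apply/funext => i.
case: (boolP [forall j, kept S s (mag (z (j, i j)))]) => [/forallP kz|].
  have e := restrict_id kz; rewrite /light /level.
  by rewrite (eq_heavy rho e) (eq_minmag e) (eq_coef e).
rewrite negb_forall => /existsP[j nk].
have -> : light rho S (restrict (kept S s) z) s i = 0.
  rewrite /light coef_minmag0 ?if_same//.
  have := minmag_le (restrict (kept S s) z) i j.
  by rewrite mag_restrict (negbTE nk) leqn0 => /eqP.
rewrite /light; case: ifPn => // /andP[_ /eqP ls].
case: (posnP (minmag z i)) => [z0|zp]; first by rewrite coef_minmag0.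
move: nk; rewrite negb_or -leqNgt => /andP[sS' mj].
have : (2 ^ s.+1 <= m %/ minmag z i)%N.
  rewrite leq_divRL// mulnC; apply: leq_trans mj.
  by rewrite leq_mul2r minmag_le orbT.
by move/(trunc_log_max (ltnSn 1)); move: ls sS'; rewrite /level; lia.
Qed.

Lemma card_supp_restrict_kept S z s :
  in_ball z -> (n <= 4 ^ S)%N -> (s <= S)%N ->
  (#|supp (restrict (kept S s) z)| <= r * 4 ^ s.+1)%N.
Proof.
move=> bz nS sS.
pose in_supp j v : nat := (j, v) \in supp (restrict (kept S s) z).
rewrite -sum1_card big_mkcond /= (eq_bigr (fun q => in_supp q.1 q.2));
  last by move=> [j v] _; rewrite /in_supp; case: (_ \in _).
rewrite -(pair_bigA _ in_supp) /=.
rewrite -[X in (_ <= X * _)%N]card_ord -sum_nat_const; apply: leq_sum => j _.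
have [->|nsS] := eqVneq s S.
  apply: (@leq_trans n); last by rewrite (leq_trans nS)// leq_pexp2l.
  rewrite -[leqRHS]card_ord -sum1_card; apply: leq_sum => v _.
  by rewrite /in_supp; case: (_ \in _).
rewrite -(leq_pmul2r (m := m ^ 2)) ?expn_gt0 ?m_gt0//.
move/forallP: bz => /(_ j) bz.
rewrite [leqRHS]mulnC; apply: leq_trans (leq_mul bz (leqnn _)).
rewrite big_distrl big_distrl /=; apply: leq_sum => v _.
rewrite /in_supp inE mag_restrict; case: ifPn => //.
rewrite /kept (negbTE nsS) /= => mk.
have -> : (4 ^ s.+1 = (2 ^ s.+1) ^ 2)%N by rewrite -expnM mulnC expnM.
case: (mag _ != 0%N); rewrite ?mul0n// mul1n -expnMn leq_exp2r//.
exact: ltnW.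
Qed.

Lemma light_form_le rho (u : R) S x z : (n <= 4 ^ S)%N ->
  (forall s z', (s <= S)%N -> in_ball z' -> (#|supp z'| <= r * 4 ^ s.+1)%N ->
     `|tensor_dot x (light rho S z' s)| <= u) ->
  in_ball z ->
  `|\sum_(s < S.+1) tensor_dot x (light rho S z s)| <= S.+1%:R * u.
Proof.
move=> nS lightu bz; apply: le_trans (ler_norm_sum _ _ _) _.
rewrite -[S.+1 in leRHS]card_ord; apply: ler_sum_card => s.
have sS : (s <= S)%N by rewrite -ltnS.
rewrite -(light_restrict rho z sS).
by apply: lightu; [|exact: in_ball_restrict|exact: card_supp_restrict_kept].
Qed.

Lemma tensor_dot_coef_split rho S x z : tensor_dot x (coef z) =
  \sum_(s < S.+1) tensor_dot x (light rho S z s) +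
  \sum_(i | heavy rho z i) x i * coef z i.
Proof.
rewrite /tensor_dot (bigID (heavy rho z)) /= addrC; congr (_ + _).
rewrite exchange_big big_mkcond /=; apply: eq_bigr => i _; rewrite -mulr_sumr.
have lS : (level S z i < S.+1)%N by rewrite ltnS geq_minl.
rewrite (bigD1 (Ordinal lS))//= /light eqxx andbT big1 ?addr0.
  by case: ifP => //; rewrite mulr0.
by move=> s; rewrite -val_eqE /= eq_sym => /negbTE ->; rewrite andbF.
Qed.

End LightHeavy.

Section SupportWeights.
Context {R : realType} (n r m : nat).

Lemma card_mag_neq0 : #|[pred g : 'I_(2 * m).+1 | mag g != 0%N]| = (2 * m)%N.
Proof.
rewrite -[RHS](_ : #|predC1 (gzero m)| = _); last first.
  by have := cardC1 (gzero m); rewrite card_ord.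
apply: eq_card => g; rewrite !inE -val_eqE /= gzeroE /mag.
by congr (~~ _); apply/eqP/eqP; lia.
Qed.

Lemma sum_expr_card_supp (omega : R) :
  \sum_(z : grid n r m) omega ^+ #|supp z| =
  (1 + (2 * m)%:R * omega) ^+ (r * n).
Proof.
pose factor (g : 'I_(2 * m).+1) : R := if mag g != 0%N then omega else 1.
transitivity (\sum_(z : grid n r m) \prod_q factor (z q)).
  apply: eq_bigr => z _; rewrite -big_mkcond /= prodr_const; congr (_ ^+ _).
  by apply: eq_card => q; rewrite !inE.
rewrite -(bigA_distr_bigA (fun _ => factor)) prodr_const card_prod !card_ord.
congr (_ ^+ _); rewrite (bigID (fun g => mag g != 0%N)) /= addrC; congr (_ + _).
  rewrite (bigD1 (gzero m)) ?mag_gzero//= /factor mag_gzero big1 ?addr0// => g.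
  by rewrite -val_eqE /= gzeroE => /andP[]; rewrite negbK /mag; lia.
rewrite -[in RHS]card_mag_neq0 mulr_natl -sumr_const; apply: eq_bigr => g g0.
by rewrite /factor g0.
Qed.

(* One factor [omega] per support point: this replaces counting the grid tuples
   of given support size in the union bounds. *)
Lemma sum_expr_card_supp_le (omega : R) : 0 <= omega ->
  (2 * m * n)%:R * omega <= 1 ->
  \sum_(z : grid n r m) omega ^+ #|supp z| <= expR r%:R.
Proof.
move=> omega0 small; rewrite sum_expr_card_supp.
apply: (@le_trans _ _ (expR ((2 * m)%:R * omega) ^+ (r * n))).
  by rewrite lerXn2r ?nnegrE ?addr_ge0 ?mulr_ge0 ?expR_ge0 ?expR_ge1Dx.
rewrite -expRM_natl ler_expR natrM -mulrA ler_piMr//.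
by rewrite mulrA -natrM mulnC.
Qed.

Lemma fprob_exists_grid_le (F : finType) (w : F -> R)
    (E : grid n r m -> pred F) (omega c : R) : pmf w ->
  0 <= omega -> (2 * m * n)%:R * omega <= 1 -> 0 <= c ->
  (forall z, fprob w (E z) <= omega ^+ #|supp z| * (expR (- r%:R) * c)) ->
  fprob w (fun f => [exists z, E z f]) <= c.
Proof.
move=> pmf_w omega0 small c0 Ec; apply: le_trans (fprob_exists pmf_w _) _.
apply: le_trans (ler_sum _ (fun z _ => Ec z)) _.
rewrite -mulr_suml mulrA ler_piMl// expRN ler_pdivrMr ?expR_gt0// mul1r.
exact: sum_expr_card_supp_le.
Qed.

End SupportWeights.

(** * The injective norm *)

Lemma norm_prod_sub_le {R : realType} (J : finType) (a b : J -> R) :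
  (forall l, `|a l| <= 1) -> (forall l, `|b l| <= 1) ->
  `|\prod_l a l - \prod_l b l| <= \sum_l `|a l - b l|.
Proof.
move=> a1 b1.
suff [] : [/\ `|\prod_l a l - \prod_l b l| <= \sum_l `|a l - b l|,
   `|\prod_l a l| <= 1 & `|\prod_l b l| <= 1] by [].
apply: (big_rec3 (fun u v d : R => [/\ `|u - v| <= d, `|u| <= 1 & `|v| <= 1])).
  by rewrite subrr normr0 normr1.
move=> l u v d _ [IH u1 v1].
split; rewrite ?normrM ?mulr_ile1 ?normr_ge0//.
have -> : a l * u - b l * v = (a l - b l) * u + b l * (u - v) by ring.
rewrite (le_trans (ler_normD _ _))// !normrM lerD//.
  by rewrite ler_piMr.
by apply: le_trans IH; rewrite ler_piMl.
Qed.

Section EuclideanNorm.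
Context {R : realType} (n : nat).
Implicit Types x : 'rV[R]_n.

Lemma l2norm_ge0 x : 0 <= l2norm x.
Proof. exact: sqrtr_ge0. Qed.

Lemma l2norm_sqr x : l2norm x ^+ 2 = \sum_(v < n) x ord0 v ^+ 2.
Proof. by rewrite sqr_sqrtr//; apply: sumr_ge0 => v _; exact: sqr_ge0. Qed.

Lemma norm_entry_le x v : `|x ord0 v| <= l2norm x.
Proof.
rewrite -ler_sqr ?nnegrE ?l2norm_ge0// l2norm_sqr real_normK ?num_real//.
by rewrite (bigD1 v)//= lerDl; apply: sumr_ge0 => u _; exact: sqr_ge0.
Qed.

Lemma l2normZ (c : R) x : 0 <= c -> l2norm (c *: x) = c * l2norm x.
Proof.
move=> c0; apply/eqP; rewrite -(@eqrXn2 _ 2) ?mulr_ge0 ?l2norm_ge0//.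
rewrite exprMn !l2norm_sqr mulr_sumr; apply/eqP/eq_bigr => v _.
by rewrite mxE exprMn.
Qed.

Lemma l2norm_delta (v : 'I_n) : l2norm (delta_mx ord0 v : 'rV[R]_n) = 1.
Proof.
apply/eqP; rewrite -(@eqrXn2 _ 2 _ 1) ?l2norm_ge0// l2norm_sqr expr1n.
rewrite (bigD1 v)//= big1 ?mxE ?eqxx ?expr1n ?addr0// => u uv.
by rewrite mxE (negbTE uv) andbF expr0n.
Qed.

Lemma l2norm_normalize x : (0 < n)%N ->
  exists2 u : 'rV[R]_n, l2norm u = 1 & x = l2norm x *: u.
Proof.
move=> n_gt0; have [x0|x0] := eqVneq (l2norm x) 0.
  exists (delta_mx ord0 (Ordinal n_gt0)); first exact: l2norm_delta.
  apply/rowP => v; rewrite x0 scale0r mxE; apply/eqP.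
  by rewrite -normr_le0 -x0 norm_entry_le.
exists ((l2norm x)^-1 *: x); last by rewrite scalerA divff// scale1r.
by rewrite l2normZ ?invr_ge0 ?l2norm_ge0// mulVf.
Qed.

End EuclideanNorm.

Section InjectiveNorm.
Context {R : realType} (n r : nat).
Hypothesis n_gt0 : (0 < n)%N.
Implicit Types A B D : tensor R n r.

Lemma inj_norm_le A (b : R) :
  (forall x : 'I_r -> 'rV[R]_n, (forall j, l2norm (x j) = 1) ->
     `|tensor_dot A (pure_tensor x)| <= b) -> inj_norm A <= b.
Proof. by move=> Ab; have [[x x1 ->] _] := inj_normP A n_gt0; exact: Ab. Qed.

Lemma inj_norm_ge0 A : 0 <= inj_norm A.
Proof. by have [[x _ ->] _] := inj_normP A n_gt0. Qed.

Lemma le_inj_norm A (y : 'I_r -> 'rV[R]_n) : (forall j, l2norm (y j) <= 1) ->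
  `|tensor_dot A (pure_tensor y)| <= inj_norm A.
Proof.
move=> y1; have [_ ub] := inj_normP A n_gt0.
have /choice[u uP] : forall j, exists u : 'rV[R]_n,
    l2norm u = 1 /\ y j = l2norm (y j) *: u.
  by move=> j; have [u u1 yu] := l2norm_normalize (y j) n_gt0; exists u.
have -> : tensor_dot A (pure_tensor y) =
    (\prod_j l2norm (y j)) * tensor_dot A (pure_tensor u).
  rewrite /tensor_dot mulr_sumr; apply: eq_bigr => i _.
  rewrite mulrCA /pure_tensor -big_split /=; congr (_ * _).
  by apply: eq_bigr => j _; rewrite {1}(uP j).2 mxE.
have dot_u : `|tensor_dot A (pure_tensor u)| <= inj_norm A.
  by apply: ub; exists u => // j; case: (uP j).
rewrite normrM; apply: le_trans dot_u.
rewrite ler_piMl// normr_prod; apply: prodr_ile1 => j _.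
by rewrite normr_ge0 ger0_norm ?l2norm_ge0 ?y1.
Qed.

Lemma inj_norm_perturb A B D (c : R) : 0 <= c ->
  (forall i, A i = c * B i + D i) ->
  inj_norm A <= c * inj_norm B + \sum_i `|D i|.
Proof.
move=> c0 AE; apply: inj_norm_le => x x1.
have -> : tensor_dot A (pure_tensor x) =
    c * tensor_dot B (pure_tensor x) + tensor_dot D (pure_tensor x).
  rewrite /tensor_dot mulr_sumr -big_split /=; apply: eq_bigr => i _.
  by rewrite AE; ring.
apply: le_trans (ler_normD _ _) _; apply: lerD.
  by rewrite normrM ger0_norm// ler_wpM2l// le_inj_norm// => j; rewrite x1.
apply: le_trans (ler_norm_sum _ _ _) _; apply: ler_sum => i _.
rewrite normrM ler_piMr// /pure_tensor normr_prod; apply: prodr_ile1 => j _.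
by rewrite normr_ge0 -(x1 j) norm_entry_le.
Qed.

Lemma le_inj_norm_grid m (z : grid n r m) A : (0 < m)%N -> in_ball z ->
  `|tensor_dot A (coef z)| <= inj_norm A.
Proof.
move=> m0 bz.
pose y j : 'rV[R]_n := \row_v gval (z (j, v)).
have -> : coef z = pure_tensor y.
  by apply/funext => i; apply: eq_bigr => j _; rewrite mxE.
apply: le_inj_norm => j.
rewrite -(@ler_sqr _ _ 1) ?nnegrE ?l2norm_ge0// l2norm_sqr expr1n.
by under eq_bigr do rewrite mxE; exact: sum_gval_sqr_le1.
Qed.

Definition grid_trunc m (x : 'I_r -> 'rV[R]_n) : grid n r m :=
  [ffun q => gtrunc m (x q.1 ord0 q.2)].

Lemma in_ball_grid_trunc m (x : 'I_r -> 'rV[R]_n) : (0 < m)%N ->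
  (forall j, l2norm (x j) = 1) -> in_ball (grid_trunc m x).
Proof.
move=> m0 x1; apply/forallP => j.
rewrite -(ler_nat R) natr_sum natrX -[leRHS]mul1r.
rewrite -ler_pdivrMr ?exprn_gt0 ?ltr0n// mulr_suml.
rewrite [leRHS](_ : _ = l2norm (x j) ^+ 2); last by rewrite x1 expr1n.
rewrite l2norm_sqr; apply: ler_sum => v _; rewrite -gval_sqr// ffunE /=.
rewrite -[leLHS]real_normK ?num_real// -[leRHS]real_normK ?num_real//.
have xv1 : `|x j ord0 v| <= 1 by rewrite -(x1 j) norm_entry_le.
by rewrite ler_sqr ?nnegrE//; have [] := gtruncP m0 xv1.
Qed.

Lemma inj_norm_grid_approx m A : (0 < m)%N ->
  exists2 z : grid n r m, in_ball z &
  inj_norm A <= `|tensor_dot A (coef z)| + (\sum_i `|A i|) * (r%:R / m%:R).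
Proof.
move=> m0; have [[x x1 ->] _] := inj_normP A n_gt0.
have xv1 j v : `|x j ord0 v| <= 1 by rewrite -(x1 j) norm_entry_le.
exists (grid_trunc m x); first exact: in_ball_grid_trunc.
rewrite -lerBlDl; apply: le_trans (lerB_dist _ _) _.
rewrite /tensor_dot -sumrB mulr_suml.
apply: le_trans (ler_norm_sum _ _ _) _; apply: ler_sum => i _.
rewrite -mulrBr normrM ler_wpM2l//.
apply: le_trans (norm_prod_sub_le _ _) _ => [j|j|]; first exact: xv1.
  exact: gval_le1.
rewrite -[r in leRHS]card_ord; apply: ler_sum_card => j.
by rewrite ffunE /=; have [] := gtruncP m0 (xv1 j (i j)).
Qed.

End InjectiveNorm.

(** * Tail bound for finitely valued entries *)

Lemma expR_half_le2 {R : realType} : expR (1 / 2) <= 2 :> R.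
Proof. by apply: le_trans (expR_le_quadratic (lexx _)) _; lra. Qed.

Section LogarithmicScales.
Context {R : realType} (n : nat).
Hypothesis n_ge2 : (2 <= n)%N.

Local Notation N := (n%:R : R).
Local Notation l := (ln N).

Lemma expR_ln_nat : expR l = N.
Proof. by rewrite lnK// posrE ltr0n ltnW. Qed.

Lemma powR_nat (a : R) : N `^ a = expR (a * l).
Proof. by rewrite /powR pnatr_eq0 gtn_eqF// ltnW. Qed.

Lemma expRM_ln_nat k : expR (k%:R * l) = (n ^ k)%:R.
Proof. by rewrite expRM_natl expR_ln_nat natrX. Qed.

Lemma ln_nat_ge_half : 1 / 2 <= l.
Proof.
rewrite -ler_expR expR_ln_nat; apply: le_trans expR_half_le2 _.
by rewrite ler_nat.
Qed.

Lemma up_log_ltn k : (1 < k)%N -> (up_log k n < n)%N.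
Proof.
move=> k1; have := up_log_gtn k1 n_ge2.
have : (0 < up_log k n)%N by rewrite up_log_gt0 k1.
have := ltn_expl (up_log k n).-1 k1; lia.
Qed.

Lemma exp2_up_log4_le s : (s <= up_log 4 n)%N -> 2 ^+ s <= 2 * Num.sqrt N.
Proof.
move=> sS; apply: (@le_trans _ _ (2 ^+ up_log 4 n)).
  by rewrite ler_eXn2l// ?ltr1n.
rewrite -ler_sqr ?nnegrE ?exprn_ge0 ?mulr_ge0 ?sqrtr_ge0//.
rewrite exprMn sqr_sqrtr// -exprM mulnC exprM -natrX -natrX -natrM ler_nat.
have /= := up_log_gtn (isT : (1 < 4)%N) n_ge2.
have : (0 < up_log 4 n)%N by rewrite up_log_gt0.
case: (up_log 4 n) => //= k _ kn.
by rewrite (_ : 2 ^ 2 = 4)%N// expnS leq_mul2l /= ltnW.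
Qed.

Lemma up_log4_le : (up_log 4 n).+1%:R <= 5 * l.
Proof.
have l_ge := ln_nat_ge_half.
suff : (up_log 4 n).-1%:R <= l.
  have : (0 < up_log 4 n)%N by rewrite up_log_gt0.
  by case: (up_log 4 n) => // k _ /=; rewrite -!natr1; lra.
have := ltnW (up_log_gtn (isT : (1 < 4)%N) n_ge2).
move: (up_log 4 n).-1 => k kn.
have expR1_le4 : expR 1 <= 4 :> R.
  have -> : expR 1 = expR (1 / 2) ^+ 2 :> R.
    by rewrite -expRM_natl; congr expR; field.
  by have := expR_half_le2 (R := R); have := expR_ge0 (1 / 2 : R); nra.
rewrite -ler_expR expR_ln_nat; apply: (@le_trans _ _ (4 ^ k)%:R).
  by rewrite -[k%:R]mulr1 expRM_natl natrX lerXn2r ?nnegrE ?expR_ge0.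
by rewrite ler_nat.
Qed.

End LogarithmicScales.

Section FiniteTensor.
Context {R : realType} (n r : nat) (eps L t : R).
Hypotheses (n_ge2 : (2 <= n)%N) (r_ge2 : (2 <= r)%N).
Hypotheses (eps_gt0 : 0 < eps) (L_ge1 : 1 <= L) (t_gt0 : 0 < t).

(* [m] is the grid resolution, [S] the last dyadic level and [tau ^+ 2] the
   threshold separating light from heavy indices. *)
Local Notation N := (n%:R : R).
Local Notation l := (ln N).
Local Notation q := (N `^ (- (eps / 4))).
Local Notation h := (Num.sqrt N).
Local Notation p := (L * N `^ (- 1 - eps)).
Local Notation m := (n ^ (2 * r + 1))%N.
Local Notation S := (up_log 4 n).
Local Notation tau := (q / (2 * h)).

Let n_gt0 : (0 < n)%N. Proof. exact: ltnW. Qed.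
Let r_gt0 : (0 < r)%N. Proof. exact: ltnW. Qed.
Let m_gt0 : (0 < m)%N. Proof. by rewrite expn_gt0 n_gt0. Qed.
Let l_ge : 1 / 2 <= l. Proof. exact: ln_nat_ge_half. Qed.
Let q_gt0 : 0 < q. Proof. by rewrite powR_gt0 ?ltr0n. Qed.
Let h_gt0 : 0 < h. Proof. by rewrite sqrtr_gt0 ltr0n. Qed.
Let tau_gt0 : 0 < tau. Proof. by rewrite divr_gt0 ?mulr_gt0. Qed.

Lemma powR_Neps_le1 : q <= 1.
Proof.
have l0 := l_ge; have e0 := eps_gt0.
by rewrite powR_nat// expR_le1 mulr_le0_ge0//; lra.
Qed.

Lemma sqrt_nat_ge1 : 1 <= h.
Proof. by rewrite -[leLHS]sqrtr1 ler_wsqrtr// ler1n. Qed.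

Lemma sparsity_ge0 : 0 <= p.
Proof. by rewrite mulr_ge0 ?powR_ge0// (le_trans ler01). Qed.

Lemma sparsityE : p = L * (q ^+ 2 / h) ^+ 2.
Proof.
rewrite expr_div_n sqr_sqrtr// !powR_nat// -!expRM_natl.
rewrite -[X in _ / X]expR_ln_nat// -expRN -expRD.
by congr (_ * expR _); field.
Qed.

Lemma expR_eps_ln : expR (eps * l) = (q ^+ 4)^-1.
Proof. by rewrite powR_nat// -expRM_natl -expRN; congr expR; field. Qed.

Lemma expR_half_eps_ln : expR (eps / 2 * l) = (q ^+ 2)^-1.
Proof. by rewrite powR_nat// -expRM_natl -expRN; congr expR; field. Qed.

Lemma fiber_mass_le j i' : #|fiber n_gt0 (r := r) j i'|%:R * p <= L * q ^+ 4.
Proof.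
apply: (@le_trans _ _ (N * p)).
  by rewrite ler_wpM2r ?sparsity_ge0// ler_nat card_fiber.
rewrite sparsityE [leLHS](_ : _ = L * q ^+ 4)// -{1}(sqr_sqrtr (ler0n R n)).
by field; rewrite gt_eqF.
Qed.

Lemma heavy_mass_le (z : grid n r m) : in_ball z ->
  #|heavy (tau ^+ 2) z|%:R * p <= 4 * L * q ^+ 2 * #|supp z|%:R.
Proof.
move=> bz; have tau2_gt0 : 0 < tau ^+ 2 by rewrite exprn_gt0.
apply: le_trans (ler_wpM2r sparsity_ge0 (card_heavy_le m_gt0 tau2_gt0 bz)) _.
rewrite sparsityE [leLHS](_ : _ = 4 * L * q ^+ 2 * #|supp z|%:R)//.
by field; rewrite !gt_eqF.
Qed.

(* The price of a support point in the union bounds over grid vectors. *)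
Definition support_factor : R := expR (- (4 * r%:R) * l).

Lemma support_factor_small : (2 * m * n)%:R * support_factor <= 1.
Proof.
rewrite /support_factor mulNr expRN -natrM expRM_ln_nat//.
rewrite ler_pdivrMr ?mul1r ?ler_nat ?ltr0n ?expn_gt0 ?n_gt0//.
apply: (@leq_trans (n * n ^ (2 * r + 1) * n)).
  by rewrite !leq_mul2r n_ge2 !orbT.
by rewrite -expnS -expnSr leq_pexp2l//; lia.
Qed.

Context (V : finType) (mu : tensor_index n r -> V -> R) (X : V -> R).
Hypothesis pmf_mu : forall i, pmf (mu i).
Hypothesis sparse_mu : forall i, fprob (mu i) (fun v => X v != 0) <= p.
Hypothesis X_le1 : forall v, `|X v| <= 1.

Local Notation prob := (fprob (prod_pmf mu)).
Local Notation dev := (centered_family mu X).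
Let pmf_prod_mu : pmf (prod_pmf mu). Proof. exact: pmf_prod. Qed.

Definition fiber_bound : R := (2 * L + 2 * r%:R + t + 2) / eps.
Definition heavy_bound : R := 2 * (8 * L + 6 * r%:R + t + 2) / eps.
Definition light_bound : R :=
  2 * L * q ^+ 3 + 68 * r%:R ^+ 2 * l * q + 2 * l * (t + 4) / h.

Lemma fiber_count_tail j i' :
  prob (fun f => fiber_bound < nonzero_count X (fiber n_gt0 j i') f) <=
  expR (- (2 * r%:R + t + 2) * l).
Proof.
have a_gt0 : 0 < eps * l by rewrite mulr_gt0//; have := l_ge; lra.
apply: le_trans (nonzero_count_tail pmf_mu sparse_mu _ _ a_gt0) _.
have -> : eps * l * fiber_bound = l * (2 * L + 2 * r%:R + t + 2).
  by rewrite /fiber_bound; field; rewrite gt_eqF.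
have mgf_le : #|fiber n_gt0 j i'|%:R * (p * expR (eps * l)) <= L.
  by rewrite expR_eps_ln mulrA ler_pdivrMr ?exprn_gt0// fiber_mass_le.
by rewrite ler_expR; have := l_ge; have := L_ge1; nra.
Qed.

Lemma fiber_tail :
  prob (fun f => [exists e : 'I_r * tensor_index n r,
    fiber_bound < nonzero_count X (fiber n_gt0 e.1 e.2) f]) <= N `^ (- (t + 2)).
Proof.
apply: le_trans (fprob_exists pmf_prod_mu _) _.
apply: le_trans (ler_sum_card (fun e => fiber_count_tail e.1 e.2)) _.
rewrite card_prod card_ord card_ffun !card_ord natrM -expRM_ln_nat// powR_nat//.
have r_le : r%:R <= expR (r%:R * l).
  rewrite expRM_ln_nat// ler_nat.
  by apply: leq_trans (ltnW (ltn_expl r (ltnSn 1))) _; rewrite leq_exp2r.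
apply: (@le_trans _ _
    (expR (r%:R * l) * expR (r%:R * l) * expR (- (2 * r%:R + t + 2) * l))).
  by rewrite !ler_wpM2r ?expR_ge0.
by rewrite -!expRD ler_expR; lra.
Qed.

Lemma heavy_count_tail (z : grid n r m) : in_ball z ->
  prob (fun f => heavy_bound * #|supp z|%:R <
                 nonzero_count X (heavy (tau ^+ 2) z) f) <=
  support_factor ^+ #|supp z| * (expR (- r%:R) * N `^ (- (t + 2))).
Proof.
move=> bz; have [z0|supp_gt0] := posnP #|supp z|.
  rewrite /fprob big_pred0.
    by rewrite !mulr_ge0 ?exprn_ge0 ?expR_ge0 ?powR_ge0.
  move=> f; apply/negbTE; rewrite -leNgt z0 mulr0.
  by rewrite /nonzero_count big1// => i; rewrite heavy_supp0.
have a_gt0 : 0 < eps / 2 * l by rewrite mulr_gt0 ?divr_gt0//; have := l_ge; lra.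
apply: le_trans (nonzero_count_tail pmf_mu sparse_mu _ _ a_gt0) _.
have mgf_le : #|heavy (tau ^+ 2) z|%:R * (p * expR (eps / 2 * l)) <=
    4 * L * #|supp z|%:R.
  rewrite expR_half_eps_ln mulrA ler_pdivrMr ?exprn_gt0// mulrAC.
  exact: heavy_mass_le.
have -> : eps / 2 * l * (heavy_bound * #|supp z|%:R) =
    l * (8 * L + 6 * r%:R + t + 2) * #|supp z|%:R.
  by rewrite /heavy_bound; field; rewrite gt_eqF.
rewrite [N `^ (- (t + 2))]powR_nat// /support_factor -expRM_natl -!expRD.
rewrite ler_expR; apply: le_trans (lerD mgf_le (lexx _)) _.
have supp_ge1 : 1 <= #|supp z|%:R :> R by rewrite ler1n.
have l0 := l_ge; have L1 := L_ge1; have t0 := t_gt0.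
have r0 : 0 <= r%:R :> R by [].
move: (#|supp z|%:R) supp_ge1 => s s1.
have L_le : 4 * L * s <= 8 * L * l * s by rewrite ler_wpM2r//; [lra | nra].
have r_le : r%:R <= 2 * r%:R * l by nra.
have tail_le : 2 * r%:R * l + (t + 2) * l <= (2 * r%:R * l + (t + 2) * l) * s.
  by rewrite ler_peMr// addr_ge0// !mulr_ge0//; lra.
by nra.
Qed.

Lemma heavy_tail :
  prob (fun f => [exists z : grid n r m, in_ball z &&
    (heavy_bound * #|supp z|%:R < nonzero_count X (heavy (tau ^+ 2) z) f)])
  <= N `^ (- (t + 2)).
Proof.
apply: (fprob_exists_grid_le pmf_prod_mu (omega := support_factor)).
- exact: expR_ge0.
- exact: support_factor_small.
- exact: powR_ge0.
move=> z; apply: fprob_andl_le; last exact: heavy_count_tail.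
by rewrite !mulr_ge0 ?exprn_ge0 ?expR_ge0 ?powR_ge0.
Qed.

Lemma light_variance_le s : (s <= S)%N ->
  2 * (2 ^+ s / (4 * tau)) ^+ 2 * p <= 2 ^+ s * h * (L * q ^+ 2).
Proof.
move=> sS; have two_s := exp2_up_log4_le (R := R) n_ge2 sS.
have -> : 2 * (2 ^+ s / (4 * tau)) ^+ 2 * p = (2 ^+ s) ^+ 2 / 2 * (L * q ^+ 2).
  by rewrite sparsityE; field; rewrite !gt_eqF.
have P0 : 0 < 2 ^+ s :> R by rewrite exprn_gt0.
apply: ler_wpM2r; last by rewrite expr2 -mulrA ler_pM2l//; lra.
by rewrite mulr_ge0 ?sqr_ge0//; have := L_ge1; lra.
Qed.

Lemma light_support_le s (sigma : R) : (s <= S)%N ->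
  sigma <= r%:R * 4 ^+ s.+1 ->
  sigma * (4 * r%:R * l) + r%:R <= 34 * (r%:R ^+ 2 * l * (2 ^+ s * h)).
Proof.
move=> sS sigma_le; have two_s := exp2_up_log4_le (R := R) n_ge2 sS.
have l0 := l_ge; have r2 : 2 <= r%:R :> R by rewrite ler_nat.
have r2l : 1 <= 2 * (r%:R * l) by nra.
have P1 : 1 <= 2 ^+ s :> R by rewrite exprn_ege1// ler1n.
have Ph1 : 1 <= 2 ^+ s * h by have := sqrt_nat_ge1; nra.
have four_s : 4 ^+ s.+1 = 4 * (2 ^+ s) ^+ 2 :> R.
  by rewrite exprS -exprM mulnC exprM; congr (_ * _ ^+ _); rewrite -natrX.
have -> : 34 * (r%:R ^+ 2 * l * (2 ^+ s * h)) =
    8 * (2 ^+ s * (2 * h)) * (2 * (r%:R * l) * r%:R) +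
    2 ^+ s * h * (2 * (r%:R * l)) * r%:R by ring.
apply: lerD; last first.
  by rewrite ler_peMl// -[leLHS]mulr1 ler_pM.
have -> : sigma * (4 * r%:R * l) = 2 * (2 * (r%:R * l)) * sigma by ring.
apply: le_trans (ler_wpM2l _ sigma_le) _; first by lra.
have -> : 2 * (2 * (r%:R * l)) * (r%:R * 4 ^+ s.+1) =
    8 * (2 ^+ s * 2 ^+ s) * (2 * (r%:R * l) * r%:R) by rewrite four_s; ring.
by apply: ler_wpM2r; [rewrite mulr_ge0//; lra|nra].
Qed.

Lemma light_exponent_le s (sigma : R) : (s <= S)%N ->
  sigma <= r%:R * 4 ^+ s.+1 ->
  2 * (2 ^+ s / (4 * tau)) ^+ 2 * p - 2 ^+ s / (4 * tau) * light_bound <=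
  sigma * (- (4 * r%:R) * l) + (- r%:R + - (t + 4) * l).
Proof.
move=> sS sigma_le.
have variance_le := light_variance_le sS.
have support_le := light_support_le sS sigma_le.
have -> : 2 ^+ s / (4 * tau) * light_bound = 2 ^+ s * h * (L * q ^+ 2) +
    34 * (r%:R ^+ 2 * l * (2 ^+ s * h)) + 2 ^+ s / q * (l * (t + 4)).
  by rewrite /light_bound; field; rewrite !gt_eqF.
have rest_le : l * (t + 4) <= 2 ^+ s / q * (l * (t + 4)).
  have l0 := l_ge; have t0 := t_gt0.
  apply: ler_peMl; first by rewrite mulr_ge0//; lra.
  rewrite ler_pdivlMr// mul1r (le_trans powR_Neps_le1)//.
  by rewrite exprn_ege1// ler1n.
by lra.
Qed.

Lemma light_form_tail s (z : grid n r m) : (s <= S)%N -> in_ball z ->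
  (#|supp z| <= r * 4 ^ s.+1)%N ->
  prob (fun f => light_bound <
                 `|tensor_dot (dev f) (light (tau ^+ 2) S z s)|) <=
  support_factor ^+ #|supp z| * (expR (- r%:R) * (2 * N `^ (- (t + 4)))).
Proof.
move=> sS bz supp_le; pose a : R := 2 ^+ s / (4 * tau).
have a_gt0 : 0 < a by apply: divr_gt0; [exact: exprn_gt0 | exact: mulr_gt0].
have coef_le i : a * `|light (tau ^+ 2) S z s i| <= 1 / 4.
  rewrite [leRHS](_ : _ = a * (tau / 2 ^+ s)).
    by rewrite ler_pM2l// norm_light_le// ltW.
  by rewrite /a; field; rewrite expf_neq0 ?gt_eqF.
have sqr_le1 : \sum_i light (tau ^+ 2) S z s i ^+ 2 <= 1.
  apply: le_trans (sum_coef_sqr_le1 (R := R) m_gt0 bz); apply: ler_sum => i _.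
  by rewrite /light; case: ifP => // _; rewrite expr0n sqr_ge0.
apply: le_trans (linear_form_tail pmf_mu sparse_mu X_le1 _ sparsity_ge0 a_gt0
  coef_le sqr_le1) _.
rewrite (mulrCA (expR _) 2) (mulrCA _ 2) ler_pM2l//.
rewrite [N `^ (- (t + 4))]powR_nat// /support_factor -expRM_natl -!expRD.
rewrite ler_expR; apply: light_exponent_le => //.
by rewrite -natrX -natrM ler_nat.
Qed.

Lemma light_tail :
  prob (fun f => [exists s : 'I_S.+1, [exists z : grid n r m,
    [&& in_ball z, (#|supp z| <= r * 4 ^ s.+1)%N &
      light_bound < `|tensor_dot (dev f) (light (tau ^+ 2) S z s)|]]])
  <= N `^ (- (t + 2)).
Proof.
have level_tail (s : 'I_S.+1) : prob (fun f => [exists z : grid n r m,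
    [&& in_ball z, (#|supp z| <= r * 4 ^ s.+1)%N &
      light_bound < `|tensor_dot (dev f) (light (tau ^+ 2) S z s)|]])
    <= 2 * N `^ (- (t + 4)).
  apply: (fprob_exists_grid_le pmf_prod_mu (omega := support_factor)).
  - exact: expR_ge0.
  - exact: support_factor_small.
  - by rewrite mulr_ge0 ?powR_ge0.
  have bound_ge0 z : 0 <= support_factor ^+ #|supp z| *
      (expR (- r%:R) * (2 * N `^ (- (t + 4)))).
    by rewrite !mulr_ge0 ?exprn_ge0 ?expR_ge0 ?powR_ge0.
  move=> z; apply: fprob_andl_le => // bz; apply: fprob_andl_le => // supp_le.
  by apply: light_form_tail => //; rewrite -ltnS.
apply: le_trans (fprob_exists pmf_prod_mu _) _.
apply: le_trans (ler_sum_card level_tail) _; rewrite card_ord mulrA.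
apply: (@le_trans _ _ (expR (2%:R * l) * N `^ (- (t + 4)))).
  rewrite ler_wpM2r ?powR_ge0// expRM_ln_nat// -natrM ler_nat.
  by have := up_log_ltn n_ge2 (isT : (1 < 4)%N); have := n_ge2; nia.
by rewrite !powR_nat// -expRD ler_expR; lra.
Qed.

Lemma grid_error_le (A : tensor R n r) : (forall i, `|A i| <= 2) ->
  (\sum_i `|A i|) * (r%:R / m%:R) <= 1.
Proof.
move=> A2; have cell_ge0 : 0 <= r%:R / m%:R :> R by rewrite divr_ge0.
apply: le_trans (ler_wpM2r cell_ge0 (ler_sum_card A2)) _.
rewrite card_ffun !card_ord !mulrA ler_pdivrMr ?ltr0n// mul1r -!natrM ler_nat.
rewrite addn1 expnS mul2n -addnn expnD.
have r_le : (r <= n ^ r)%N.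
  by apply: leq_trans (ltnW (ltn_expl r (ltnSn 1))) _; rewrite leq_exp2r.
by rewrite -mulnA mulnC -mulnA; do 2![apply: leq_mul => //].
Qed.

Definition inj_bound : R := S.+1%:R * light_bound +
  r%:R * ((heavy_bound + 4 * L) + (fiber_bound + L)) / 2 + 1.

Lemma inj_norm_le_inj_bound f :
  (forall s z, (s <= S)%N -> in_ball z -> (#|supp z| <= r * 4 ^ s.+1)%N ->
     `|tensor_dot (dev f) (light (m := m) (tau ^+ 2) S z s)| <= light_bound) ->
  (forall z, in_ball z ->
     nonzero_count X (heavy (m := m) (tau ^+ 2) z) f <=
     heavy_bound * #|supp z|%:R) ->
  (forall j i', nonzero_count X (fiber n_gt0 j i') f <= fiber_bound) ->
  inj_norm (dev f) <= inj_bound.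
Proof.
move=> light_le heavy_le fiber_le.
have L0 : 0 <= L by apply: le_trans L_ge1.
have t0 := ltW t_gt0; have r0 : 0 <= r%:R :> R by [].
have dev2 := norm_centered_family_le2 pmf_mu X_le1 f.
have [z bz zinj] := inj_norm_grid_approx n_gt0 (dev f) m_gt0.
apply: le_trans zinj _; apply: lerD; last exact: grid_error_le.
rewrite (tensor_dot_coef_split (tau ^+ 2) S).
apply: le_trans (ler_normD _ _) _; apply: lerD.
  by apply: light_form_le light_le bz => //; exact: up_logP.
pose b i : R := (X (f i) != 0)%:R + p.
have sum_b (A : pred (tensor_index n r)) :
    \sum_(i | A i) b i = nonzero_count X A f + #|A|%:R * p.
  by rewrite big_split sumr_const mulr_natl.
have K0 : 0 <= heavy_bound + 4 * L.
  by apply: addr_ge0; [apply: divr_ge0; [lra|exact: ltW]|lra].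
have k0 : 0 <= fiber_bound + L.
  by apply: addr_ge0; [apply: divr_ge0; [lra|exact: ltW]|].
have q2 : q ^+ 2 <= 1 by rewrite exprn_ile1 ?powR_Neps_le1 ?ltW.
apply: (heavy_form_le m_gt0 r_gt0 (n_gt0 := n_gt0) (b := b)) => //.
- exact: norm_centered_family_le.
- move=> z' bz'; rewrite sum_b (mulrDl heavy_bound); apply: lerD.
    exact: heavy_le.
  apply: le_trans (heavy_mass_le bz') _; rewrite ler_wpM2r//.
  by rewrite ler_piMr// mulr_ge0.
- move=> j i'; rewrite sum_b; apply: lerD; first exact: fiber_le.
  apply: le_trans (fiber_mass_le j i') _; rewrite ler_piMr//.
  by rewrite exprn_ile1 ?powR_Neps_le1 ?ltW.
Qed.

Lemma inj_norm_dev_tail :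
  prob (fun f => inj_bound < inj_norm (dev f)) <= N `^ (- t).
Proof.
apply: (@le_trans _ _
    (N `^ (- (t + 2)) + (N `^ (- (t + 2)) + N `^ (- (t + 2))))); last first.
  rewrite !powR_nat//; have -> : - (t + 2) * l = - t * l + - (2%:R * l) by ring.
  rewrite expRD expRN expRM_ln_nat//; have := expR_gt0 (- t * l).
  have : (n ^ 2)%:R^-1 <= 4^-1 :> R.
    rewrite lef_pV2 ?posrE ?ltr0n ?expn_gt0 ?n_gt0// ler_nat.
    by rewrite -[4%N]/(2 ^ 2)%N leq_exp2r.
  by nra.
apply: le_trans (lerD light_tail (lerD heavy_tail fiber_tail)).
apply: le_trans (lerD (lexx _) (fprob_or pmf_prod_mu _ _)).
apply: le_trans (fprob_or pmf_prod_mu _ _).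
apply: le_fprob => // f; apply: contraTT; rewrite !negb_or -leNgt.
move=> /and3P[/existsPn no_light /existsPn no_heavy /existsPn no_fiber].
apply: inj_norm_le_inj_bound => [s z sS bz supp_le|z bz|j i'].
- have /existsPn/(_ z) := no_light (Ordinal (sS : (s < S.+1)%N)).
  by rewrite bz supp_le -leNgt.
- by have := no_heavy z; rewrite bz -leNgt.
- by have := no_fiber (j, i'); rewrite -leNgt.
Qed.

End FiniteTensor.
Section Decay.
Context {R : realType}.
Implicit Types a x : R.

Lemma mul_expRN_le a x : 0 < a -> x * expR (- a * x) <= a^-1.
Proof.
move=> a0; rewrite mulNr expRN ler_pdivrMr ?expR_gt0// ler_pdivlMl//.
by apply: le_trans (expR_ge1Dx _); lra.
Qed.

Lemma sqr_mul_expRN_le a x : 0 < a -> 0 <= x ->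
  x ^+ 2 * expR (- (2 * a) * x) <= a^-1 ^+ 2.
Proof.
move=> a0 x0.
have -> : x ^+ 2 * expR (- (2 * a) * x) = (x * expR (- a * x)) ^+ 2.
  by rewrite exprMn -expRM_natl; congr (_ * expR _); ring.
rewrite ler_sqr ?nnegrE ?invr_ge0 ?(ltW a0) ?mulr_ge0 ?expR_ge0//.
exact: mul_expRN_le.
Qed.

End Decay.

Definition tail_const {R : realType} : R := 400 * 33.

Lemma tail_const_gt0 {R : realType} : 0 < tail_const :> R.
Proof. by rewrite /tail_const; lra. Qed.

Definition tail_scale {R : realType} (n r : nat) (eps t : R) : R :=
  Cconst n r eps + r%:R ^+ 3 * t / eps.

Section Constants.
Context {R : realType} (n r : nat) (eps : R).
Hypotheses (n_ge2 : (2 <= n)%N) (r_ge2 : (2 <= r)%N).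
Hypotheses (eps_gt0 : 0 < eps) (eps_lt1 : eps < 1).

Local Notation N := (n%:R : R).
Local Notation l := (ln N).
Local Notation q := (N `^ (- (eps / 4))).
Local Notation h := (Num.sqrt N).
Local Notation rho := (r%:R : R).

Let l_ge : 1 / 2 <= l. Proof. exact: ln_nat_ge_half. Qed.
Let rho_ge2 : 2 <= rho. Proof. by rewrite ler_nat. Qed.
Let inv_eps_ge1 : 1 <= eps^-1. Proof. by rewrite invf_ge1// ltW. Qed.

Definition log_loss : R := l ^+ 2 * q.

Lemma log_loss_ge0 : 0 <= log_loss.
Proof. by rewrite mulr_ge0 ?sqr_ge0 ?powR_ge0. Qed.

Lemma ln_mul_cube_le : l * q ^+ 3 <= 4 / 3 / eps.
Proof.
have a_gt0 : 0 < 3 / 4 * eps by rewrite mulr_gt0// divr_gt0.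
have -> : q ^+ 3 = expR (- (3 / 4 * eps) * l).
  by rewrite powR_nat// -expRM_natl; congr expR; field.
apply: le_trans (mul_expRN_le _ a_gt0) _.
by rewrite [leLHS](_ : _ = 4 / 3 / eps)//; field; rewrite gt_eqF.
Qed.

Lemma sqr_ln_div_sqrt_le : l ^+ 2 / h <= 16.
Proof.
have -> : h^-1 = expR (- (2 * 4^-1) * l).
  by rewrite -powR12_sqrt// powR_nat// -expRN; congr expR; field.
apply: le_trans (sqr_mul_expRN_le _ _) _ => //; last by rewrite invrK; lra.
by have := l_ge; lra.
Qed.

Lemma log_loss_le : log_loss <= 64 / eps ^+ 2.
Proof.
have -> : log_loss = l ^+ 2 * expR (- (2 * (eps / 8)) * l).
  by rewrite /log_loss powR_nat//; congr (_ * expR _); field.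
apply: le_trans (sqr_mul_expRN_le _ _) _.
- by rewrite divr_gt0.
- by have := l_ge; lra.
- by rewrite [leLHS](_ : _ = 64 / eps ^+ 2)//; field; rewrite gt_eqF.
Qed.

(* In the first regime [n ^ (eps / 4)] beats [ln n ^+ 2]. *)
Lemma Cconst_small_order : rho <= eps * l / (5 * ln l) ->
  Cconst n r eps = rho ^+ 4 / eps /\ log_loss <= 1.
Proof.
move=> rho_le; rewrite /Cconst rho_le; split=> //.
have l_half := l_ge; have rho2 := rho_ge2; have e0 := eps_gt0.
have lnl_gt0 : 0 < ln l.
  rewrite ltNge; apply/negP => lnl_le0.
  suff : eps * l / (5 * ln l) <= 0 by lra.
  by apply: mulr_ge0_le0; [nra|rewrite invr_le0; lra].
move: rho_le; rewrite ler_pdivlMr; last by lra.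
move=> rho_le; have l_expR : l = expR (ln l) by rewrite lnK// posrE; lra.
rewrite /log_loss powR_nat// {1}l_expR -expRM_natl -expRD.
by rewrite -[leRHS]expR0 ler_expR; nra.
Qed.

Lemma Cconst_large_order : ~~ (rho <= eps * l / (5 * ln l)) ->
  rho ^+ 5 / eps ^+ 2 / 4 <= Cconst n r eps.
Proof.
move=> /negbTE rho_gt; rewrite /Cconst rho_gt.
have e0 := eps_gt0; have e1 := eps_lt1; have rho2 := rho_ge2.
have ln_ge : 1 / 2 <= ln (rho / eps).
  apply: le_trans (ln_nat_ge_half (R := R) (isT : (1 < 2)%N)) _.
  by rewrite ler_ln ?posrE ?divr_gt0//; [rewrite ler_pdivlMr//; nra|lra].
by rewrite ler_wpM2l ?divr_ge0 ?exprn_ge0 ?(ltW e0)//; nra.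
Qed.

Lemma log_loss_le_Cconst :
  rho ^+ 2 / eps + rho ^+ 2 * log_loss <= 33 * Cconst n r eps.
Proof.
have rho2 := rho_ge2; have inv1 := inv_eps_ge1.
have rho_sqr_ge : 4 <= rho ^+ 2 by nra.
have rho_sqr0 : 0 <= rho ^+ 2 by exact: sqr_ge0.
have [small|large] := boolP (rho <= eps * l / (5 * ln l)).
  have [-> loss_le1] := Cconst_small_order small.
  have rho4 : 4 * rho ^+ 2 <= rho ^+ 4 by rewrite (exprD _ 2 2); nra.
  have loss_le : rho ^+ 2 * log_loss <= rho ^+ 2 / eps.
    by rewrite ler_wpM2l// (le_trans loss_le1).
  have : 4 * rho ^+ 2 / eps <= rho ^+ 4 / eps.
    by rewrite ler_wpM2r// invr_ge0 ltW.
  have : 0 <= rho ^+ 2 / eps by rewrite divr_ge0// ltW.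
  lra.
apply: le_trans (_ : 33 * (rho ^+ 5 / eps ^+ 2 / 4) <= _); last first.
  by rewrite ler_pM2l// Cconst_large_order.
have rho_cube_ge : 8 <= rho ^+ 3 by rewrite exprS; nra.
have rho5 : 8 * rho ^+ 2 <= rho ^+ 5 by rewrite (exprD _ 3 2) ler_wpM2r.
have loss_le : rho ^+ 2 * log_loss <= rho ^+ 2 * (64 / eps ^+ 2).
  by rewrite ler_wpM2l// log_loss_le.
rewrite -exprVn in loss_le *; move: (eps^-1) inv1 loss_le => e inv1 loss_le.
have : rho ^+ 2 * e <= rho ^+ 2 * e ^+ 2 by rewrite ler_wpM2l//; nra.
have : 8 * rho ^+ 2 * e ^+ 2 <= rho ^+ 5 * e ^+ 2 by rewrite ler_wpM2r ?sqr_ge0.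
have : 0 <= rho ^+ 2 * e ^+ 2 by rewrite mulr_ge0 ?sqr_ge0.
lra.
Qed.

Lemma Cconst_ge_cube : rho ^+ 3 / eps <= Cconst n r eps.
Proof.
have e0 := eps_gt0; have rho2 := rho_ge2; have inv1 := inv_eps_ge1.
have rho3 : 0 <= rho ^+ 3 by rewrite exprn_ge0.
have [small|large] := boolP (rho <= eps * l / (5 * ln l)).
  have [-> _] := Cconst_small_order small.
  by rewrite ler_wpM2r ?invr_ge0 ?(ltW e0)// [leRHS]exprS; nra.
apply: le_trans (Cconst_large_order large).
rewrite -exprVn; move: (eps^-1) inv1 => e inv1.
have : rho ^+ 3 * e <= rho ^+ 3 * e ^+ 2 by rewrite ler_wpM2l//; nra.
have : 4 * rho ^+ 3 * e ^+ 2 <= rho ^+ 5 * e ^+ 2.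
  apply: ler_wpM2r; first exact: sqr_ge0.
  by rewrite (exprD _ 2 3); apply: ler_wpM2r => //; nra.
have : 0 <= rho ^+ 3 * e ^+ 2 by rewrite mulr_ge0 ?sqr_ge0.
lra.
Qed.

Lemma Cconst_ge1 : 1 <= Cconst n r eps.
Proof.
apply: le_trans Cconst_ge_cube; rewrite ler_pdivlMr// mul1r.
by apply: le_trans (ltW eps_lt1) _; rewrite exprn_ege1// ler1n ltnW.
Qed.

Lemma tail_scale_ge1 (t : R) : 0 <= t -> 1 <= tail_scale n r eps t.
Proof.
move=> t0; apply: le_trans Cconst_ge1 _.
by rewrite lerDl !mulr_ge0 ?invr_ge0 ?exprn_ge0// ltW.
Qed.

Variables L t : R.
Hypotheses (L_ge1 : 1 <= L) (t_gt0 : 0 < t).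

Lemma light_total_le : (up_log 4 n).+1%:R * light_bound n r eps L t <=
  40 / 3 * (L / eps) + 340 * (rho ^+ 2 * log_loss) + 160 * (t + 4).
Proof.
have l0 := l_ge; have L1 := L_ge1; have t0 := t_gt0.
have light_ge0 : 0 <= light_bound n r eps L t.
  rewrite /light_bound.
  by rewrite !addr_ge0 ?divr_ge0 ?mulr_ge0 ?exprn_ge0 ?powR_ge0
    ?sqrtr_ge0//; lra.
apply: le_trans (ler_wpM2r light_ge0 (up_log4_le n_ge2)) _.
have -> : 5 * l * light_bound n r eps L t = 10 * L * (l * q ^+ 3) +
    340 * (rho ^+ 2 * log_loss) + 10 * (t + 4) * (l ^+ 2 / h).
  by rewrite /light_bound /log_loss; ring.
apply: lerD; first apply: lerD => //.
  have -> : 40 / 3 * (L / eps) = 10 * L * (4 / 3 / eps) by ring.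
  by rewrite ler_wpM2l ?ln_mul_cube_le//; lra.
have -> : 160 * (t + 4) = 10 * (t + 4) * 16 by ring.
by rewrite ler_wpM2l ?sqr_ln_div_sqrt_le//; lra.
Qed.

Lemma inj_bound_le : inj_bound n r eps L t <=
  400 * L * (rho ^+ 2 / eps + rho ^+ 2 * log_loss + rho * t / eps).
Proof.
have L1 := L_ge1; have t0 := t_gt0; have rho2 := rho_ge2.
apply: le_trans (lerD (lerD light_total_le (lexx _)) (lexx _)) _.
have loss0 : 0 <= rho ^+ 2 * log_loss.
  by rewrite mulr_ge0 ?sqr_ge0 ?log_loss_ge0.
have loss_le : 340 * (rho ^+ 2 * log_loss) <= 400 * L * (rho ^+ 2 * log_loss).
  by rewrite ler_wpM2r//; lra.
pose counts := rho *
  ((heavy_bound r eps L t + 4 * L) + (fiber_bound r eps L t + L)) / 2.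
suff rest_le : 40 / 3 * (L / eps) + 160 * (t + 4) + counts + 1 <=
    400 * L * (rho ^+ 2 + rho * t) / eps.
  rewrite -/counts [leRHS](_ : _ = 400 * L * (rho ^+ 2 * log_loss) +
    400 * L * (rho ^+ 2 + rho * t) / eps); [lra | ring].
have -> : counts =
    rho * (9 * L + 7 * rho + 3 / 2 * t + 3) / eps + 5 / 2 * (rho * L).
  by rewrite /counts /heavy_bound /fiber_bound; field; rewrite gt_eqF.
apply: (@le_trans _ _ ((40 / 3 * L + 160 * (t + 4) +
    rho * (9 * L + 7 * rho + 3 / 2 * t + 3) + 5 / 2 * (rho * L) + 1) / eps)).
  suff : 160 * (t + 4) + 5 / 2 * (rho * L) + 1 <=
      (160 * (t + 4) + 5 / 2 * (rho * L) + 1) / eps by lra.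
  by rewrite ler_peMr//; nra.
rewrite ler_wpM2r ?invr_ge0 ?(ltW eps_gt0)//.
have L_le : 2 * L <= L * rho by nra.
have rhoL_le : 2 * (L * rho) <= L * rho ^+ 2 by nra.
have rho_le : rho <= L * rho by nra.
have rho_sqr_le : rho ^+ 2 <= L * rho ^+ 2 by nra.
have t_le : 2 * t <= L * rho * t by nra.
have rhot_le : rho * t <= L * rho * t by nra.
nra.
Qed.

Lemma inj_bound_le_tail_scale :
  inj_bound n r eps L t <= tail_const * L * tail_scale n r eps t.
Proof.
apply: le_trans inj_bound_le _.
have t_le : rho * t / eps <= rho ^+ 3 * t / eps.
  rewrite ler_wpM2r ?invr_ge0 ?(ltW eps_gt0)// ler_wpM2r ?(ltW t_gt0)//.
  by rewrite ler_eXnr// ler1n ltnW.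
have rest_ge0 : 0 <= rho ^+ 3 * t / eps.
  by rewrite !mulr_ge0 ?invr_ge0 ?exprn_ge0// ltW.
have -> : tail_const * L * tail_scale n r eps t =
    400 * L * (33 * Cconst n r eps + 33 * (rho ^+ 3 * t / eps)).
  by rewrite /tail_const /tail_scale; ring.
apply: ler_wpM2l; first by have := L_ge1; lra.
by have := log_loss_le_Cconst; lra.
Qed.

End Constants.

Section FiniteTailMean.
Context {R : realType} (n r : nat) (eps L : R).
Hypotheses (n_ge2 : (2 <= n)%N) (r_ge2 : (2 <= r)%N).
Hypotheses (eps_gt0 : 0 < eps) (eps_lt1 : eps < 1) (L_ge1 : 1 <= L).
Context (V : finType) (mu : tensor_index n r -> V -> R) (X : V -> R).
Hypothesis pmf_mu : forall i, pmf (mu i).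
Hypothesis sparse_mu :
  forall i, fprob (mu i) (fun v => X v != 0) <= L * n%:R `^ (- 1 - eps).
Hypothesis X_le1 : forall v, `|X v| <= 1.

Local Notation dev := (centered_family mu X).

Lemma prod_pmf_inj_norm_tail (t : R) : 0 < t ->
  fprob (prod_pmf mu)
    (fun f => tail_const * L * tail_scale n r eps t < inj_norm (dev f)) <=
  n%:R `^ (- t).
Proof.
move=> t0.
apply: le_trans (inj_norm_dev_tail n_ge2 r_ge2 eps_gt0 L_ge1 t0 pmf_mu
  sparse_mu X_le1).
apply: (le_fprob (pmf_prod pmf_mu)) => f; apply: le_lt_trans.
exact: inj_bound_le_tail_scale.
Qed.

Lemma prod_pmf_inj_norm_mean :
  fmean (prod_pmf mu) (fun f => inj_norm (dev f)) <=
  3 * tail_const * L * Cconst n r eps.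
Proof.
pose a := tail_const * L * Cconst n r eps.
pose b := tail_const * L * (r%:R ^+ 3 / eps).
have cL_gt0 : 0 < tail_const * L.
  by apply: mulr_gt0; [exact: tail_const_gt0 | exact: lt_le_trans L_ge1].
have b_gt0 : 0 < b.
  by apply: mulr_gt0 => //; rewrite divr_gt0 ?exprn_gt0 ?ltr0n// ltnW.
have b_le_a : b <= a by rewrite ler_pM2l// Cconst_ge_cube.
apply: (@le_trans _ _ (a + 2 * b)); last first.
  by rewrite [leRHS](_ : _ = 3 * a); [lra | rewrite /a; ring].
apply: fmean_le_geometric_tail => //; first exact: pmf_prod.
move=> k; apply: (@le_trans _ _ (n%:R `^ (- k.+1%:R))).
  apply: le_trans (prod_pmf_inj_norm_tail (ltr0Sn _ k)).
  apply: (le_fprob (pmf_prod pmf_mu)) => f; apply: le_lt_trans.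
  rewrite [leLHS](_ : _ = a + b * k.+1%:R)//.
  by rewrite /a /b /tail_scale; ring.
rewrite powRN powR_mulrn// -exprVn lerXn2r ?nnegrE ?invr_ge0//.
by rewrite lef_pV2 ?posrE ?ltr0n ?ler_nat// ltnW.
Qed.

End FiniteTailMean.

(** * Independent entries and large entries *)

Section FiniteValued.
Context {d : measure_display} {Omega : measurableType d} {R : realType}.
Variable P : probability Omega R.
Context (F : finType) (g : Omega -> F).
Hypothesis measurable_fiber : forall v, measurable (g @^-1` [set v]).

Lemma finite_valued_eventE (Q : pred F) :
  [set w | Q (g w)] = \big[setU/set0]_(v | Q v) (g @^-1` [set v]).
Proof.
rewrite -(bigcup_pred Q); apply/seteqP.
by split=> [w Qw|w [v Qv] gv]; [exists (g w) | rewrite /= gv].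
Qed.

Lemma measurable_finite_valued (Q : pred F) : measurable [set w | Q (g w)].
Proof. by rewrite finite_valued_eventE; exact: bigsetU_measurable. Qed.

Lemma measurable_fun_finite_valued (phi : F -> R) :
  measurable_fun setT (fun w => phi (g w)).
Proof.
move=> _ B _; rewrite setTI.
have -> : (fun w => phi (g w)) @^-1` B = [set w | `[< B (phi (g w)) >]].
  by apply/seteqP; split => w /asboolP.
exact: (measurable_finite_valued (fun v => `[< B (phi v) >])).
Qed.

Lemma integral_finite_valued (phi : F -> R) :
  (\int[P]_w (phi (g w))%:E = \sum_v (phi v)%:E * P (g @^-1` [set v]))%E.
Proof.
have int_indic v : P.-integrable setT (EFin \o \1_(g @^-1` [set v])).
  exact: (integrable_indic P (measurable_fiber v)).
transitivity (\int[P]_w (\sum_v (phi v)%:E * (\1_(g @^-1` [set v]) w)%:E))%E.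
  apply: eq_integral => w _; rewrite (bigD1 (g w))//= big1 ?adde0.
    by rewrite indicE mem_set// mule1.
  by move=> v vw; rewrite indicE memNset ?mule0//= => gw; rewrite gw eqxx in vw.
rewrite integral_sum => [|//|v]; last first.
  by apply: integrableZl => //; exact: int_indic.
apply: eq_bigr => v _; rewrite integralZl//; last exact: int_indic.
by rewrite integral_indic// setIT.
Qed.

Lemma prob_finite_valued (Q : pred F) :
  (P [set w | Q (g w)] = \sum_(v | Q v) P (g @^-1` [set v]))%E.
Proof.
rewrite -[X in P X]setIT -integral_indic//;
  last exact: measurable_finite_valued.
rewrite [RHS]big_mkcond /=.
transitivity (\int[P]_w ((Q (g w))%:R : R)%:E)%E.
  apply: eq_integral => w _; rewrite indicE; congr ((nat_of_bool _)%:R%:E).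
  by apply/idP/idP => [/set_mem|/mem_set].
rewrite (integral_finite_valued (fun v => (Q v)%:R)).
by apply: eq_bigr => v _; case: (Q v); rewrite ?mul1e ?mul0e.
Qed.

End FiniteValued.

Lemma measurable_gtr_set {d : measure_display} {T : measurableType d}
    {R : realType} (f : T -> R) (a : R) :
  measurable_fun setT f -> measurable [set x | a < f x].
Proof.
move=> mf; have := mf measurableT _ (measurable_itv `]a, +oo[).
by rewrite setTI preimage_itvoy.
Qed.

Lemma integral_probability_cst {d : measure_display} {T : measurableType d}
    {R : realType} (P : probability T R) (c : R) : (\int[P]_w c%:E = c%:E)%E.
Proof. by rewrite -[RHS](expectation_cst P) unlock. Qed.

Lemma ge0_integral_mrestr {d : measure_display} {T : measurableType d}
    {R : realType} (mu : {measure set T -> \bar R}) (C : set T)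
    (mC : measurable C) (g : T -> \bar R) :
  measurable_fun setT g -> (forall x, 0 <= g x)%E ->
  (\int[mrestr mu mC]_x g x = \int[mu]_(x in C) g x)%E.
Proof.
move=> mg g0; have mC' := measurableC mC.
rewrite -(setvU C) setUC ge0_integral_setU//.
- rewrite [X in (_ + X)%E]null_set_integral ?adde0//.
  + by apply: eq_measure_integral => A mA sub; rewrite /= /mrestr (setIidl sub).
  + exact: measurable_funS mg.
  + by rewrite /= /mrestr setICl measure0.
- exact: measurable_funS mg.
- by apply/disj_setPS => x [].
Qed.

Lemma integral_independent_event {d : measure_display}
    {Omega : measurableType d} {R : realType} (P : probability Omega R)
    (C : set Omega) (X : {RV P >-> R}) (f : R -> R) : measurable C ->
  (forall A, measurable A -> P ((X @^-1` A) `&` C) = P C * P (X @^-1` A))%E ->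
  measurable_fun setT f -> (forall x, 0 <= f x) ->
  (\int[P]_(w in C) (f (X w))%:E = P C * \int[P]_w (f (X w))%:E)%E.
Proof.
move=> mC indep mf f0.
have mfE : measurable_fun setT (EFin \o f) by apply/measurable_EFinP.
have mX : measurable_fun setT X by exact: measurable_funP.
have push nu :=
  ge0_integral_pushforward mX nu measurableT mfE (fun y _ => f0 y).
rewrite preimage_setT in push.
pose c : {nonneg R} := NngNum (fine_ge0 (measure_ge0 P C)).
have cE : (c%:num%:E = P C)%E by rewrite fineK// fin_num_measure.
rewrite -(ge0_integral_mrestr P mC (measurableT_comp mfE mX)) => [|w];
  last by rewrite lee_fin.
rewrite -[LHS]push -[in RHS]push -cE.
rewrite (eq_measure_integral (mscale c (pushforward P X))) => [|A mA _].
  by rewrite ge0_integral_mscale// => x _; rewrite lee_fin.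
rewrite /= /mscale /mrestr /pushforward /= indep//.
by rewrite cE.
Qed.

Section Independence.
Context {d : measure_display} {Omega : measurableType d} {R : realType}.
Variable P : probability Omega R.
Context (I : finType) (X : I -> {RV P >-> R}).
Hypothesis indepX : mutually_independent X.
Implicit Types A : I -> set R.

Lemma independent_forall A : (forall i, measurable (A i)) ->
  (P [set w | forall i, A i (X i w)] = \prod_i P (X i @^-1` A i))%E.
Proof.
move=> mA; have := indepX [set: I]%SET mA.
under [in RHS]eq_bigl do rewrite inE.
move=> <-; congr (P _); apply/seteqP; split => w /= h i.
  by move=> _; exact: h.
by apply: h; rewrite /= inE.
Qed.

Lemma measurable_forall A : (forall i, measurable (A i)) ->
  measurable [set w | forall i, A i (X i w)].
Proof.
move=> mA.
have -> : [set w | forall i, A i (X i w)] =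
    \bigcap_(i in [set: I]) (X i @^-1` A i).
  apply/seteqP.
  by split => w h i; [move=> _; exact: h|exact: (h i Logic.I)].
apply: fin_bigcap_measurable => [|i _]; first exact: finite_finset.
exact: measurable_funPTI.
Qed.

Definition others (i : I) (B : set R) : set Omega :=
  [set w | forall k, k != i -> B (X k w)].

Definition slot (i : I) (A B : set R) (k : I) : set R :=
  if k == i then A else B.

Lemma measurable_slot i (A B : set R) : measurable A -> measurable B ->
  forall k, measurable (slot i A B k).
Proof. by move=> mA mB k; rewrite /slot; case: ifP. Qed.

Lemma setI_others i (A B : set R) : (X i @^-1` A) `&` others i B =
  [set w | forall k, slot i A B k (X k w)].
Proof.
apply/seteqP; split => w /=.
  by move=> [Ai Bk] k; rewrite /slot; case: eqVneq => [->//|ki]; exact: Bk.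
move=> h; split; first by have := h i; rewrite /slot eqxx.
by move=> k ki; have := h k; rewrite /slot (negbTE ki).
Qed.

Lemma others_slot i (B : set R) :
  others i B = [set w | forall k, slot i setT B k (X k w)].
Proof. by rewrite -setI_others preimage_setT setTI. Qed.

Lemma measurable_others i (B : set R) :
  measurable B -> measurable (others i B).
Proof.
move=> mB; rewrite others_slot; apply: measurable_forall.
exact: measurable_slot.
Qed.

Lemma independent_others i (A B : set R) : measurable A -> measurable B ->
  (P ((X i @^-1` A) `&` others i B) = P (others i B) * P (X i @^-1` A))%E.
Proof.
move=> mA mB; rewrite setI_others others_slot.
rewrite !independent_forall; try exact: measurable_slot.
rewrite (bigD1 i)//= [in RHS](bigD1 i)//= /slot eqxx.
rewrite preimage_setT probability_setT mul1e muleC.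
by congr (_ * _)%E; apply: eq_bigr => k /negbTE ->.
Qed.

End Independence.

Section TensorSupNorm.
Context {R : realType} (n r : nat).
Implicit Types A : tensor R n r.

Lemma le_tensor_sup_norm A i : `|A i| <= tensor_sup_norm A.
Proof. exact: (le_bigmax _ (fun i => `|A i|)). Qed.

Lemma tensor_sup_norm_ge0 A : 0 <= tensor_sup_norm A.
Proof. exact: bigmax_ge_id. Qed.

Lemma tensor_sup_norm_le A (c : R) :
  0 <= c -> (forall i, `|A i| <= c) -> tensor_sup_norm A <= c.
Proof. by move=> c0 Ac; apply: bigmax_le. Qed.

Lemma tensor_sup_norm_le_sum A : tensor_sup_norm A <= \sum_i `|A i|.
Proof.
apply: tensor_sup_norm_le => [|i]; first exact: sumr_ge0.
by rewrite (bigD1 i)//= lerDl sumr_ge0.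
Qed.

Lemma measurable_tensor_sup_norm {d : measure_display} {T : measurableType d}
    (A : T -> tensor R n r) :
  (forall i, measurable_fun setT (fun x => A x i)) ->
  measurable_fun setT (fun x => tensor_sup_norm (A x)).
Proof.
move=> mA; rewrite /tensor_sup_norm; elim: (index_enum _) => [|i s IH].
  by under eq_fun do rewrite big_nil; exact: measurable_cst.
under eq_fun do rewrite big_cons.
by apply: measurable_maxr => //; exact: measurableT_comp.
Qed.

(* The injective norm is a countable supremum over grid vectors. *)
Lemma measurable_inj_norm {d : measure_display} {T : measurableType d}
    (A : T -> tensor R n r) : (0 < n)%N ->
  (forall i, measurable_fun setT (fun x => A x i)) ->
  measurable_fun setT (fun x => inj_norm (A x)).
Proof.
move=> n_gt0 mA _; apply: (measurability _ (RGenOInfty.measurableE R)) => //.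
move=> _ [_ [c ->] <-]; rewrite setTI preimage_itvoy.
pose grid_event k (z : grid n r k.+1) : set T :=
  if in_ball z then [set x | c < `|tensor_dot (A x) (coef z)|] else set0.
have -> : [set x | c < inj_norm (A x)] =
    \bigcup_k \bigcup_(z in [set: grid n r k.+1]) grid_event k z.
  apply/seteqP; split => x /=; last first.
    move=> [k _ [z _]]; rewrite /grid_event; case: ifP => // bz /= cz.
    by apply: lt_le_trans cz _; exact: le_inj_norm_grid.
  rewrite -subr_gt0 => gap_gt0; set gap := _ - c in gap_gt0.
  pose k := Num.truncn ((\sum_i `|A x i|) * r%:R / gap).
  have [z bz approx] := inj_norm_grid_approx n_gt0 (A x) (ltn0Sn k).
  exists k => //; exists z => //; rewrite /grid_event bz /=.
  have := truncnS_gt ((\sum_i `|A x i|) * r%:R / gap).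
  rewrite ltr_pdivrMr// -/k [ltRHS]mulrC -ltr_pdivrMr ?ltr0n//.
  by rewrite -mulrA /gap; move: (_ * (_ / _)) approx => error; lra.
apply: bigcup_measurable => k _.
apply: fin_bigcup_measurable => [|z _]; first exact: finite_finset.
rewrite /grid_event; case: ifP => // _; apply: measurable_gtr_set.
apply: measurableT_comp => //; apply: measurable_sum => i.
exact: measurable_funM.
Qed.

End TensorSupNorm.

Section LargeEntries.
Context {d : measure_display} {Omega : measurableType d} {R : realType}.
Variable P : probability Omega R.
Context (n r : nat) (T : tensor_index n r -> {RV P >-> R}) (M : R).
Hypothesis M_gt0 : 0 < M.

Local Notation sup_norm w := (tensor_sup_norm (sample T w)).

Lemma measurable_sup_norm : measurable_fun setT (fun w => sup_norm w).
Proof. by apply: measurable_tensor_sup_norm => i; exact: measurable_funP. Qed.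

Definition excess (x : R) : R := if M < `|x| then `|x| else 0.

Lemma excess_ge0 x : 0 <= excess x.
Proof. by rewrite /excess; case: ifP. Qed.

Lemma measurable_excess : measurable_fun setT excess.
Proof. by apply: measurable_fun_ifT => //; exact: measurable_fun_ltr. Qed.

Lemma measurable_excess_entry i :
  measurable_fun setT (fun w => (excess (T i w))%:E).
Proof.
by apply/measurable_EFinP; exact: measurableT_comp measurable_excess _.
Qed.

Lemma prob_sup_norm_gt_le :
  (M%:E * P [set w | (M < sup_norm w)%R] <= \int[P]_w (sup_norm w)%:E)%E.
Proof.
have mN : measurable_fun setT (fun w => (sup_norm w)%:E).
  exact/measurable_EFinP/measurable_sup_norm.
have := le_integral_abse P measurableT mN M_gt0.
under [X in (_ <= X)%E -> _]eq_integral => w _ do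
  rewrite gee0_abs ?lee_fin ?tensor_sup_norm_ge0//.
apply: le_trans; rewrite lee_pmul2l ?lte_fin//.
apply: le_measure; rewrite ?inE//.
- exact: measurable_gtr_set measurable_sup_norm.
- by apply: emeasurable_fun_c_infty => //; exact: measurableT_comp.
- move=> w /= Mw; split=> //.
  by rewrite lee_fin ger0_norm ?tensor_sup_norm_ge0 ?ltW.
Qed.

Let small := [set x : R | `|x| <= M].

Let measurable_small : measurable small.
Proof.
rewrite (_ : small = `[- M, M]%classic) //.
by apply/seteqP; split => x; rewrite /small /= in_itv /= ler_norml.
Qed.

Hypothesis indepT : mutually_independent T.
Hypothesis mean_sup_norm : (2%:E * \int[P]_w (sup_norm w)%:E <= M%:E)%E.

Lemma prob_all_small : (2^-1%:E <= P [set w | forall i, small (T i w)])%E.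
Proof.
have -> : [set w | forall i, small (T i w)] = ~` [set w | M < sup_norm w].
  apply/seteqP; split => w /= h.
    by apply/negP; rewrite -leNgt; apply: tensor_sup_norm_le => //; exact: ltW.
  move=> i; apply: le_trans (le_tensor_sup_norm (sample T w) i) _.
  by rewrite leNgt; exact/negP.
have m_large := measurable_gtr_set M measurable_sup_norm.
rewrite probability_setC//.
have := le_trans (lee_wpmul2l _ prob_sup_norm_gt_le) mean_sup_norm.
rewrite -(fineK (fin_num_measure P _ m_large)).
rewrite -!EFinM -EFinB !lee_fin => /(_ (ler0n R 2)).
by have := M_gt0; nra.
Qed.

Lemma prob_others_small i : (2^-1%:E <= P (others T i small))%E.
Proof.
apply: le_trans prob_all_small _; apply: le_measure; rewrite ?inE.
- exact: (measurable_forall T (fun=> measurable_small)).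
- exact: measurable_others.
- by move=> w h k _; exact: h.
Qed.

(* At most one term is nonzero: the others are then all small. *)
Lemma sum_excess_others_le w :
  \sum_i (if w \in others T i small then excess (T i w) else 0) <= sup_norm w.
Proof.
case: (boolP [exists i, (w \in others T i small) && (M < `|T i w|)]).
  move=> /existsP[i /andP[wi Mi]]; have small_others := set_mem wi.
  rewrite (bigD1 i)//= wi /excess Mi big1 ?addr0.
    exact: (le_tensor_sup_norm (sample T w)).
  by move=> k ki; rewrite ltNge (small_others k ki) /=; case: ifP.
rewrite negb_exists => /forallP h; rewrite big1 ?tensor_sup_norm_ge0// => i _.
by have := h i; rewrite /excess; case: (w \in _) => //= /negbTE ->.
Qed.

Lemma excess_le_others i : (\int[P]_w (excess (T i w))%:E <=
  2%:E * \int[P]_(w in others T i small) (excess (T i w))%:E)%E.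
Proof.
rewrite (integral_independent_event (C := others T i small) (f := excess)).
- rewrite muleA -[leLHS]mul1e lee_wpmul2r//.
    by apply: integral_ge0 => w _; rewrite lee_fin excess_ge0.
  have := lee_wpmul2l (_ : 0 <= 2%:E)%E (prob_others_small i).
  by rewrite -EFinM mulfV// lee_fin; apply.
- exact: measurable_others.
- by move=> A mA; exact: independent_others.
- exact: measurable_excess.
- exact: excess_ge0.
Qed.

Lemma sum_integral_excess_le : (\sum_i \int[P]_w (excess (T i w))%:E <= M%:E)%E.
Proof.
have m_others i : measurable (others T i small) by exact: measurable_others.
have m_patch i :
    measurable_fun setT ((fun w => (excess (T i w))%:E) \_ (others T i small)).
  apply/(measurable_restrictT _ (m_others i)).
  exact: measurable_funS (measurable_excess_entry i).
have patch_ge0 i w :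
    (0 <= ((fun w => (excess (T i w))%:E) \_ (others T i small)) w)%E.
  by apply: erestrict_ge0 => v _; rewrite lee_fin excess_ge0.
apply: le_trans (lee_sum _ (fun i _ => excess_le_others i)) _.
apply: le_trans mean_sup_norm.
rewrite -ge0_sume_distrr => [|i _]; last first.
  by apply: integral_ge0 => w _; rewrite lee_fin excess_ge0.
apply: lee_wpmul2l => //.
under eq_bigr do rewrite integral_mkcond.
rewrite -ge0_integral_sum//; apply: ge0_le_integral => //.
- by move=> w _; exact: sume_ge0.
- exact: emeasurable_sum.
- exact/measurable_EFinP/measurable_sup_norm.
- move=> w _; apply: (@le_trans _ _
    (\sum_i if w \in others T i small then excess (T i w) else 0)%:E).
    by rewrite -sumEFin; apply: lee_sum => i _; rewrite patchE; case: ifP.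
  by rewrite lee_fin sum_excess_others_le.
Qed.

End LargeEntries.

Section Quantization.
Context {R : realType} (M : R) (D : nat).
Hypotheses (M_gt0 : 0 < M) (D_gt0 : (0 < D)%N).

Definition quantize (x : R) : 'I_(2 * D).+1 :=
  if `|x| <= M then gtrunc D (x / M) else gzero D.

Lemma norm_div_le1 (x : R) : `|x| <= M -> `|x / M| <= 1.
Proof.
by move=> xM; rewrite normrM normfV (gtr0_norm M_gt0) ler_pdivrMr ?mul1r.
Qed.

Lemma quantize_dist x :
  `|x - M * gval (quantize x)| <= M / D%:R + excess M x.
Proof.
rewrite /quantize /excess [`|x| <= M]leNgt; case: (ltP M `|x|) => xM /=.
  have /eqP -> : gval (gzero D) == 0 :> R by rewrite gval_eq0// mag_gzero.
  by rewrite mulr0 subr0 lerDr divr_ge0// ltW.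
have [_ dist] := gtruncP D_gt0 (norm_div_le1 xM).
rewrite addr0 -{1}[x](mulfVK (lt0r_neq0 M_gt0)) mulrC -mulrBr.
by rewrite normrM (gtr0_norm M_gt0) ler_pM2l// mulrC.
Qed.

Lemma gval_quantize0 : gval (quantize 0) = 0 :> R.
Proof.
have norm0 : `|0 : R| <= M by rewrite normr0 ltW.
have [gval_le _] := gtruncP D_gt0 (norm_div_le1 norm0).
apply/eqP; rewrite -normr_le0 /quantize norm0.
by apply: le_trans gval_le _; rewrite mul0r normr0.
Qed.

Lemma measurable_quantize v : measurable (quantize @^-1` [set v]).
Proof.
pose A := [set x : R | `|x| <= M /\ gtrunc D (x / M) = v].
pose B := [set x : R | M < `|x| /\ gzero D = v].
have -> : quantize @^-1` [set v] = A `|` B.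
  apply/seteqP; split => x; rewrite /A /B /= /quantize.
    by case: leP => xM h; [left|right].
  by case=> [[-> //]|[]]; rewrite leNgt => ->.
apply: measurableU.
  apply: is_interval_measurable => x y [xM xv] [yM yv] z /andP[xz zy].
  have zM : `|z| <= M.
    move: xM yM; rewrite !ler_norml => /andP[Mx _] /andP[_ yM'].
    by rewrite (le_trans Mx)// (le_trans zy).
  split => //; apply/val_inj/eqP; rewrite eqn_leq; apply/andP.
  by split; [rewrite -yv|rewrite -xv]; apply: gtrunc_homo => //;
    rewrite ?norm_div_le1// ler_pM2r ?invr_gt0.
have [gv|gv] := pselect (gzero D = v); last first.
  by rewrite (_ : B = set0)//; apply/seteqP; split => x // [].
have -> : B = [set x : R | M < `|x|] by apply/seteqP; split => x; [case|split].
by apply: (measurable_gtr_set M); exact: normr_measurable.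
Qed.

End Quantization.

(** * Reduction to finitely many values *)

Section Quantized.
Context {d : measure_display} {Omega : measurableType d} {R : realType}.
Variable P : probability Omega R.
Context (n r : nat) (T : tensor_index n r -> {RV P >-> R}).
Hypotheses (n_ge2 : (2 <= n)%N) (r_ge2 : (2 <= r)%N).
Hypothesis indepT : mutually_independent T.
Hypothesis intT : forall i, P.-integrable [set: Omega] (EFin \o T i).

Local Notation sup_norm w := (tensor_sup_norm (sample T w)).

Let n_gt0 : (0 < n)%N. Proof. exact: ltnW. Qed.

Lemma measurable_inj_norm_centered :
  measurable_fun setT (fun w => inj_norm (centered T w)).
Proof. by apply: measurable_inj_norm => // i; exact: measurable_funB. Qed.

Lemma EFin_mean_tensor i : (mean_tensor T i)%:E = (\int[P]_w (T i w)%:E)%E.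
Proof.
rewrite /mean_tensor unlock fineK//.
exact: (integrable_fin_num measurableT (intT i)).
Qed.

Lemma integral_sup_norm_fin_num : (\int[P]_w (sup_norm w)%:E)%E \is a fin_num.
Proof.
have m_entry i : measurable_fun setT (fun w => `|T i w|%:E).
  by apply/measurable_EFinP; exact: measurableT_comp.
rewrite ge0_fin_numE; last first.
  by apply: integral_ge0 => w _; rewrite lee_fin tensor_sup_norm_ge0.
apply: (@le_lt_trans _ _ (\int[P]_w (\sum_i `|T i w|%:E))%E).
  apply: ge0_le_integral => //.
  - by move=> w _; rewrite lee_fin tensor_sup_norm_ge0.
  - exact/measurable_EFinP/measurable_sup_norm.
  - exact: emeasurable_sum.
  - by move=> w _; rewrite sumEFin lee_fin tensor_sup_norm_le_sum.
rewrite ge0_integral_sum//.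
by apply: lte_sum_pinfty => i _; case/integrableP: (intT i).
Qed.

Lemma norm_mean_tensor_le i :
  (`|mean_tensor T i|%:E <= \int[P]_w (sup_norm w)%:E)%E.
Proof.
have mT : measurable_fun setT (fun w => (T i w)%:E) by exact/measurable_EFinP.
rewrite -[leLHS]/(`|(mean_tensor T i)%:E|%E) EFin_mean_tensor.
apply: le_trans (le_abse_integral P measurableT mT) _.
apply: ge0_le_integral => //.
- exact: measurableT_comp.
- exact/measurable_EFinP/measurable_sup_norm.
- by move=> w _; rewrite lee_fin (le_tensor_sup_norm (sample T w)).
Qed.

Lemma inj_norm_centered_gt0 w : (\int[P]_w (sup_norm w)%:E <= 0)%E ->
  0 < inj_norm (centered T w) -> 0 < sup_norm w.
Proof.
move=> mean0.
rewrite [in X in _ -> X]lt_neqAle tensor_sup_norm_ge0 andbT eq_sym.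
apply: contraTneq => Nw; rewrite -leNgt; apply: inj_norm_le => // x _.
rewrite /tensor_dot big1 ?normr0// => i _; rewrite /centered.
have -> : sample T w i = 0.
  by apply/eqP; rewrite -normr_le0 -Nw le_tensor_sup_norm.
have -> : mean_tensor T i = 0.
  by apply/eqP; rewrite -normr_le0 -lee_fin (le_trans (norm_mean_tensor_le i)).
by rewrite subr0 mul0r.
Qed.

Variables (eps L : R).
Hypotheses (eps_gt0 : 0 < eps) (eps_lt1 : eps < 1) (L_ge1 : 1 <= L).
Hypothesis sparseT : forall i,
  (P [set w | T i w <> 0%R] <= (L * n%:R `^ (- 1 - eps))%:E)%E.
Variable M : R.
Hypothesis M_gt0 : 0 < M.
Hypothesis mean_sup_norm : (2%:E * \int[P]_w (sup_norm w)%:E <= M%:E)%E.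

Local Notation D := (2 * n ^ r)%N.
Local Notation value := (@gval R D).
Let D_gt0 : (0 < D)%N. Proof. by rewrite muln_gt0 expn_gt0 n_gt0. Qed.

Definition quantized_entry i (w : Omega) : 'I_(2 * D).+1 :=
  quantize M D (T i w).

Definition quantized_sample (w : Omega) :
  {ffun tensor_index n r -> 'I_(2 * D).+1} := [ffun i => quantized_entry i w].

Definition quantized_law i (v : 'I_(2 * D).+1) : R :=
  fine (P (quantized_entry i @^-1` [set v])).

Local Notation qmean i := (fmean (quantized_law i) value).
Local Notation dev := (centered_family quantized_law value).

Definition quantization_error i (w : Omega) : R :=
  T i w - M * value (quantized_entry i w).

Lemma measurable_quantized_entry i v :
  measurable (quantized_entry i @^-1` [set v]).
Proof.
exact: (measurable_funPTI (T i) (measurable_quantize M_gt0 D_gt0 v)).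
Qed.

Lemma quantized_sample_preimage f : quantized_sample @^-1` [set f] =
  [set w | forall i, (quantize M D @^-1` [set f i]) (T i w)].
Proof.
apply/seteqP; split => w /= => [<- i|h]; first by rewrite ffunE.
by apply/ffunP => i; rewrite ffunE; exact: h.
Qed.

Lemma measurable_quantized_sample f :
  measurable (quantized_sample @^-1` [set f]).
Proof.
rewrite quantized_sample_preimage.
exact: (measurable_forall T (fun i => measurable_quantize M_gt0 D_gt0 (f i))).
Qed.

Lemma quantized_lawE i v :
  (quantized_law i v)%:E = P (quantized_entry i @^-1` [set v]).
Proof.
by rewrite fineK// fin_num_measure//; exact: measurable_quantized_entry.
Qed.

Lemma fprob_quantized_law i (Q : pred 'I_(2 * D).+1) :
  (fprob (quantized_law i) Q)%:E = P [set w | Q (quantized_entry i w)].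
Proof.
rewrite (prob_finite_valued P (measurable_quantized_entry i)) -sumEFin.
by apply: eq_bigr => v _; rewrite quantized_lawE.
Qed.

Lemma pmf_quantized_law i : pmf (quantized_law i).
Proof.
split=> [v|]; first exact: fine_ge0.
apply: EFin_inj; rewrite (fprob_quantized_law i xpredT).
by rewrite (_ : [set w | _] = setT) ?probability_setT//; apply/seteqP.
Qed.

Lemma sparse_quantized_law i :
  fprob (quantized_law i) (fun v => value v != 0) <= L * n%:R `^ (- 1 - eps).
Proof.
rewrite -lee_fin; apply: le_trans (sparseT i); rewrite fprob_quantized_law.
apply: le_measure; rewrite ?inE.
- exact: (measurable_finite_valued (measurable_quantized_entry i)
    (fun v => value v != 0)).
- rewrite (_ : [set w | _] = T i @^-1` (~` [set 0])); last by [].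
  by apply: measurable_funPTI; exact: measurableC.
- move=> w /= /eqP value_neq0 Tw0; apply: value_neq0.
  by rewrite /quantized_entry Tw0; exact: gval_quantize0.
Qed.

Lemma prob_quantized_sample_eq f :
  P (quantized_sample @^-1` [set f]) = (prod_pmf quantized_law f)%:E.
Proof.
have m_preimage i : measurable (quantize M D @^-1` [set f i]).
  exact: measurable_quantize.
rewrite quantized_sample_preimage (independent_forall indepT m_preimage).
by rewrite -prodEFin; apply: eq_bigr => i _; rewrite quantized_lawE.
Qed.

Lemma prob_quantized_sample (E : pred _) :
  P [set w | E (quantized_sample w)] = (fprob (prod_pmf quantized_law) E)%:E.
Proof.
rewrite (prob_finite_valued P measurable_quantized_sample) -sumEFin.
by apply: eq_bigr => f _; rewrite prob_quantized_sample_eq.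
Qed.

Lemma integral_quantized_sample (phi : {ffun tensor_index n r -> _} -> R) :
  (\int[P]_w (phi (quantized_sample w))%:E =
   (fmean (prod_pmf quantized_law) phi)%:E)%E.
Proof.
rewrite (integral_finite_valued P measurable_quantized_sample) -sumEFin.
by apply: eq_bigr => f _; rewrite prob_quantized_sample_eq -EFinM mulrC.
Qed.

Lemma measurable_quantization_error i :
  measurable_fun setT (quantization_error i).
Proof.
apply: measurable_funB => //; apply: measurable_funM => //.
exact: (measurable_fun_finite_valued (measurable_quantized_entry i)).
Qed.

Lemma measurable_norm_quantization_error i :
  measurable_fun setT (fun w => `|quantization_error i w|%:E).
Proof.
apply/measurable_EFinP; apply: measurableT_comp => //.
exact: measurable_quantization_error.
Qed.

Lemma integral_norm_quantization_error_le i :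
  (\int[P]_w (`|quantization_error i w|)%:E <=
   (M / D%:R)%:E + \int[P]_w (excess M (T i w))%:E)%E.
Proof.
have mX := measurable_excess_entry T M i.
have cell_ge0 : 0 <= M / D%:R by rewrite divr_ge0// ltW.
rewrite -[X in (_ <= X + _)%E](integral_probability_cst P).
rewrite -ge0_integralD//; last first.
  by move=> w _; rewrite lee_fin excess_ge0.
apply: ge0_le_integral => //.
- exact: measurable_norm_quantization_error.
- exact: emeasurable_funD.
- by move=> w _; rewrite -EFinD lee_fin; exact: quantize_dist.
Qed.

Lemma mean_quantization_error_le i : (`|mean_tensor T i - M * qmean i|%:E <=
  \int[P]_w (`|quantization_error i w|)%:E)%E.
Proof.
have mq := measurable_fun_finite_valued (measurable_quantized_entry i)
  (fun v => M * value v).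
have int_q :
    (\int[P]_w (M * value (quantized_entry i w))%:E = (M * qmean i)%:E)%E.
  rewrite (integral_finite_valued P (measurable_quantized_entry i)
    (fun v => M * value v)).
  rewrite mulr_sumr -sumEFin; apply: eq_bigr => v _.
  by rewrite -quantized_lawE -EFinM; congr EFin; ring.
have integrable_q :
    P.-integrable setT (EFin \o (fun w => M * value (quantized_entry i w))).
  apply: (le_integrable measurableT (g := EFin \o cst M)).
  - exact/measurable_EFinP.
  - by move=> w _ /=; rewrite lee_fin normrM ler_piMr//; exact: gval_le1.
  - exact: finite_measure_integrable_cst.
have m_err : measurable_fun setT (fun w => (quantization_error i w)%:E).
  exact/measurable_EFinP/measurable_quantization_error.
apply: le_trans (le_abse_integral P measurableT m_err).
under eq_integral do rewrite EFinB.
by rewrite integralB_EFin// int_q -EFin_mean_tensor -EFinB.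
Qed.

Lemma sum_cell_width : \sum_(i : tensor_index n r) M / D%:R = M / 2.
Proof.
rewrite sumr_const card_ffun !card_ord -mulr_natl natrM invfM.
by field; rewrite pnatr_eq0 -lt0n expn_gt0 n_gt0.
Qed.

Lemma sum_integral_quantization_error_le :
  (\sum_i \int[P]_w (`|quantization_error i w|)%:E <= (3 / 2 * M)%:E)%E.
Proof.
have excess_le := sum_integral_excess_le M_gt0 indepT mean_sup_norm.
apply: (@le_trans _ _
    (\sum_i ((M / D%:R)%:E + \int[P]_w (excess M (T i w))%:E))%E).
  by apply: lee_sum => i _; exact: integral_norm_quantization_error_le.
rewrite big_split /= sumEFin sum_cell_width.
by apply: le_trans (leeD2l _ excess_le) _; rewrite -EFinD lee_fin; lra.
Qed.

Lemma inj_norm_centered_le w :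
  inj_norm (centered T w) <= M * inj_norm (dev (quantized_sample w)) +
    \sum_i `|quantization_error i w| + 3 / 2 * M.
Proof.
have mean_err_le : \sum_i `|mean_tensor T i - M * qmean i| <= 3 / 2 * M.
  rewrite -lee_fin -sumEFin; apply: le_trans sum_integral_quantization_error_le.
  by apply: lee_sum => i _; exact: mean_quantization_error_le.
have decomp i : centered T w i = M * dev (quantized_sample w) i +
    (quantization_error i w - (mean_tensor T i - M * qmean i)).
  by rewrite /centered /sample /centered_family /quantization_error ffunE; ring.
apply: le_trans (inj_norm_perturb n_gt0 (ltW M_gt0) decomp) _.
rewrite -addrA lerD2l; apply: le_trans (lerD (lexx _) mean_err_le).
by rewrite -big_split; apply: ler_sum => i _; exact: ler_normB.
Qed.

Lemma inj_norm_centered_le_of_bounded w : sup_norm w <= M ->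
  inj_norm (centered T w) <= M * inj_norm (dev (quantized_sample w)) + 2 * M.
Proof.
move=> wM; have := inj_norm_centered_le w.
suff : \sum_i `|quantization_error i w| <= M / 2 by lra.
rewrite -sum_cell_width; apply: ler_sum => i _.
have entry_le : `|T i w| <= M.
  by apply: le_trans wM; exact: (le_tensor_sup_norm (sample T w)).
have := quantize_dist M_gt0 D_gt0 (T i w).
by rewrite /excess ltNge entry_le /= addr0.
Qed.

Lemma inj_norm_dev_gt (C t : R) w : tail_const + 2 <= C -> 0 <= t ->
  sup_norm w <= M ->
  C * L * M * tail_scale n r eps t < inj_norm (centered T w) ->
  tail_const * L * tail_scale n r eps t < inj_norm (dev (quantized_sample w)).
Proof.
move=> C_ge t0 wM inj_gt; set scale := tail_scale n r eps t in inj_gt *.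
have Lscale_ge1 : 1 <= L * scale by rewrite mulr_ege1// tail_scale_ge1.
have C_le : (tail_const + 2) * (L * scale * M) <= C * (L * scale * M).
  by rewrite ler_wpM2r// mulr_ge0 ?(ltW M_gt0)// (le_trans ler01).
have M_le : M <= L * scale * M by rewrite ler_peMl// ltW.
have := lt_le_trans inj_gt (inj_norm_centered_le_of_bounded wM).
have -> : C * L * M * scale = C * (L * scale * M) by ring.
rewrite -(ltr_pM2l M_gt0 (tail_const * L * scale)).
have -> : M * (tail_const * L * scale) = tail_const * (L * scale * M) by ring.
by lra.
Qed.

Lemma prob_inj_norm_gt_scale_le (C t : R) : tail_const + 2 <= C -> 0 < t ->
  (P [set w | (C * L * M * tail_scale n r eps t < inj_norm (centered T w))%R] <=
   (n%:R `^ (- t))%:E + P [set w | (M < sup_norm w)%R])%E.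
Proof.
move=> C_ge t0.
pose E f := tail_const * L * tail_scale n r eps t < inj_norm (dev f).
have mE : measurable [set w | E (quantized_sample w)].
  exact: (measurable_finite_valued measurable_quantized_sample E).
have m_large := measurable_gtr_set M (measurable_sup_norm T).
apply: (@le_trans _ _
    (P ([set w | E (quantized_sample w)] `|` [set w | M < sup_norm w]))).
  apply: le_measure; rewrite ?inE.
  - exact: (measurable_gtr_set _ measurable_inj_norm_centered).
  - exact: measurableU.
  move=> w /= inj_gt; have [wM|] := leP (sup_norm w) M; [left|by right].
  exact: inj_norm_dev_gt C_ge (ltW t0) wM inj_gt.
apply: le_trans (measureU2 P mE m_large) _; apply: leeD => //.
apply: (@le_trans _ _ (fprob (prod_pmf quantized_law) E)%:E).
  by rewrite -(prob_quantized_sample E).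
rewrite lee_fin; apply: prod_pmf_inj_norm_tail => //.
- exact: pmf_quantized_law.
- exact: sparse_quantized_law.
- exact: gval_le1.
Qed.

Lemma integral_inj_norm_centered_le :
  (\int[P]_w (inj_norm (centered T w))%:E <=
   (M * fmean (prod_pmf quantized_law) (fun f => inj_norm (dev f)) +
    3 * M)%:E)%E.
Proof.
pose inj_dev w := inj_norm (dev (quantized_sample w)).
pose error w := (\sum_i `|quantization_error i w|%:E)%E.
have m_dev : measurable_fun setT (fun w => (inj_dev w)%:E).
  apply/measurable_EFinP.
  exact: (measurable_fun_finite_valued measurable_quantized_sample
    (fun f => inj_norm (dev f))).
have dev_ge0 w : (0 <= (inj_dev w)%:E)%E by rewrite lee_fin inj_norm_ge0.
have Mdev_ge0 w : (0 <= M%:E * (inj_dev w)%:E)%E.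
  by rewrite mule_ge0// lee_fin ltW.
have m_entry_error := measurable_norm_quantization_error.
have m_error : measurable_fun setT error by exact: emeasurable_sum.
have error_ge0 w : (0 <= error w)%E by apply: sume_ge0.
have cst_ge0 : 0 <= 3 / 2 * M by rewrite mulr_ge0// ltW.
apply: (@le_trans _ _
    (\int[P]_w (M%:E * (inj_dev w)%:E + (error w + (3 / 2 * M)%:E)))%E).
  apply: ge0_le_integral => //.
  - by move=> w _; rewrite lee_fin inj_norm_ge0.
  - exact/measurable_EFinP/measurable_inj_norm_centered.
  - apply: emeasurable_funD; first exact: measurable_funeM.
    exact: emeasurable_funD.
  - move=> w _; rewrite /error sumEFin -EFinM -!EFinD lee_fin addrA.
    exact: inj_norm_centered_le.
rewrite ge0_integralD//; [|exact: measurable_funeM| |exact: emeasurable_funD];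
  last by move=> w _; rewrite adde_ge0.
rewrite ge0_integralZl//; last by rewrite lee_fin ltW.
rewrite ge0_integralD// integral_probability_cst ge0_integral_sum//.
rewrite (integral_quantized_sample (fun f => inj_norm (dev f))).
apply: le_trans (leeD2l _ (leeD2r _ sum_integral_quantization_error_le)) _.
by rewrite -EFinM -!EFinD lee_fin; lra.
Qed.

Lemma integral_inj_norm_le_scale : (\int[P]_w (inj_norm (centered T w))%:E <=
  ((3 * tail_const + 3) * L * Cconst n r eps * M)%:E)%E.
Proof.
apply: le_trans integral_inj_norm_centered_le _; rewrite lee_fin.
have mean_le := prod_pmf_inj_norm_mean n_ge2 r_ge2 eps_gt0 eps_lt1 L_ge1
  pmf_quantized_law sparse_quantized_law (gval_le1 D_gt0).
apply: le_trans (lerD (ler_wpM2l (ltW M_gt0) mean_le) (lexx _)) _.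
have LC_ge1 : 1 <= L * Cconst n r eps by rewrite mulr_ege1// Cconst_ge1.
have M_le : M <= L * Cconst n r eps * M by rewrite ler_peMl// ltW.
have -> : M * (3 * tail_const * L * Cconst n r eps) =
    3 * tail_const * (L * Cconst n r eps * M) by ring.
have -> : (3 * tail_const + 3) * L * Cconst n r eps * M =
    3 * tail_const * (L * Cconst n r eps * M) + 3 * (L * Cconst n r eps * M).
  by ring.
by lra.
Qed.

End Quantized.

Definition universal_const {R : realType} : R := 2 * (3 * tail_const + 3).

Section MainBounds.
Context {d : measure_display} {Omega : measurableType d} {R : realType}.
Variable P : probability Omega R.
Context (n r : nat) (eps L : R) (T : tensor_index n r -> {RV P >-> R}).
Hypotheses (n_ge2 : (2 <= n)%N) (r_ge2 : (2 <= r)%N).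
Hypotheses (eps_gt0 : 0 < eps) (eps_lt1 : eps < 1) (L_ge1 : 1 <= L).
Hypothesis indepT : mutually_independent T.
Hypothesis intT : forall i, P.-integrable [set: Omega] (EFin \o T i).
Hypothesis sparseT : forall i,
  (P [set w | T i w <> 0%R] <= (L * n%:R `^ (- 1 - eps))%:E)%E.

Local Notation sup_norm w := (tensor_sup_norm (sample T w)).

Lemma inj_norm_centered_mean : ('E_P[fun w => inj_norm (centered T w)] <=
  (universal_const * Cconst n r eps * L)%:E * 'E_P[fun w => sup_norm w])%E.
Proof.
have := expectation_ge0 P (fun w => tensor_sup_norm_ge0 (sample T w)).
rewrite unlock; have /fineK meanE := integral_sup_norm_fin_num intT.
rewrite -meanE lee_fin.
move: (fine _) meanE => e meanE e_ge0.
pose K := (3 * tail_const + 3) * L * Cconst n r eps.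
have K_gt0 : 0 < K.
  apply: mulr_gt0; last by apply: lt_le_trans (Cconst_ge1 _ _ _ _).
  by apply: mulr_gt0; have := tail_const_gt0 (R := R); have := L_ge1; lra.
apply/lee_addgt0Pr => dl dl_gt0.
(* [M] must be positive, whereas [e] may be [0]. *)
have M_gt0 : 0 < 2 * e + dl / K by rewrite ltr_wpDl ?mulr_ge0// divr_gt0.
have mean_le : (2%:E * \int[P]_w (sup_norm w)%:E <= (2 * e + dl / K)%:E)%E.
  by rewrite -meanE -EFinM lee_fin lerDl ltW// divr_gt0.
apply: le_trans (integral_inj_norm_le_scale n_ge2 r_ge2 indepT intT eps_gt0
  eps_lt1 L_ge1 sparseT M_gt0 mean_le) _.
rewrite -EFinM -EFinD lee_fin -/K mulrDr [K * (dl / K)]mulrC divfK ?gt_eqF//.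
rewrite [leLHS](_ : _ = universal_const * Cconst n r eps * L * e + dl)//.
by rewrite /universal_const /K; ring.
Qed.

Lemma inj_norm_centered_tail (t M : R) : 0 < t ->
  (2%:E * 'E_P[fun w => sup_norm w] <= M%:E)%E ->
  (P [set w | (universal_const * L * M * tail_scale n r eps t <
               inj_norm (centered T w))%R] <=
   (n%:R `^ (- t))%:E + P [set w | (M < sup_norm w)%R])%E.
Proof.
have := expectation_ge0 P (fun w => tensor_sup_norm_ge0 (sample T w)).
rewrite unlock => mean_ge0 t_gt0 mean_le.
have [M_gt0|M_le0] := ltP 0 M.
  apply: prob_inj_norm_gt_scale_le => //.
  by rewrite /universal_const; have := tail_const_gt0 (R := R); lra.
have M0 : M = 0.
  apply/eqP; rewrite eq_le M_le0 -lee_fin; apply: le_trans mean_le.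
  by rewrite mule_ge0.
rewrite M0 in mean_le *; rewrite mulr0 mul0r.
apply: (@le_trans _ _ (P [set w | 0 < sup_norm w])); last first.
  by rewrite leeDr// lee_fin powR_ge0.
apply: le_measure; rewrite ?inE.
- by apply: measurable_gtr_set; exact: measurable_inj_norm_centered.
- by apply: measurable_gtr_set; exact: measurable_sup_norm.
move=> w; apply: inj_norm_centered_gt0 => //.
by move: mean_le; rewrite -[leRHS](mule0 2%:E) lee_pmul2l// lte_fin.
Qed.

End MainBounds.

Theorem corollary4p3 (R : realType) :
  exists C0 : R, 0 < C0 /\
  forall (n r : nat) (eps L : R)
    (d : measure_display) (Omega : measurableType d) (P : probability Omega R)
    (T : tensor_index n r -> {RV P >-> R}),
    (2 <= n)%N -> (2 <= r)%N -> 0 < eps -> eps < 1 -> 1 <= L ->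
    mutually_independent T ->
    (forall i, P.-integrable [set: Omega] (EFin \o T i)) ->
    (forall i, (P [set w | T i w <> 0%R] <= (L * n%:R `^ (- 1 - eps))%:E)%E) ->
    ('E_P[fun w => inj_norm (centered T w)] <=
       (C0 * Cconst n r eps * L)%:E *
       'E_P[fun w => tensor_sup_norm (sample T w)])%E /\
    (forall t M : R, 0 < t ->
       (2%:E * 'E_P[fun w => tensor_sup_norm (sample T w)] <= M%:E)%E ->
       (P [set w | (C0 * L * M * (Cconst n r eps + r%:R ^+ 3 * t / eps) <
                    inj_norm (centered T w))%R] <=
        (n%:R `^ (- t))%:E +
        P [set w | (M < tensor_sup_norm (sample T w))%R])%E).
Proof.
exists universal_const; split.
  by rewrite /universal_const; have := tail_const_gt0 (R := R); lra.
move=> n r eps L d Omega P T n2 r2 eps0 eps1 L1 indepT intT sparseT; split.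
  exact: inj_norm_centered_mean.
by move=> t M; exact: inj_norm_centered_tail.
Qed.
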